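(* Let $T>0$, $L>0$, $\sigma>0$, $\epsilon\ge 0$ and $r$ be given constants and let $u_T,m_0:[0,L]\to\mathbb{R}$ satisfy the standing assumptions on the data (listed in the context). Suppose $(u,m)$ is a smooth solution on $[0,T]\times[0,L]$ of the system (S) written in the context. (i) For any $\delta>0$ (with $\delta<L$), there exists a constant $C_\delta>0$, depending only on the data and $\delta$, such that $$\left|\int_{0}^{L-\delta} u_x(t,x)m(t,x)\,dx \right| \leq C_{\delta} \quad \forall t \in [0,T].$$ (ii) For any $\delta>0$ (with $\delta<L$), there exists a constant $C_\delta>0$, depending only on the data and $\delta$, such that $$\left|\int_{\delta}^{L} u_x(t,x)m(t,x)\,dx \right| \leq C_{\delta} \quad \forall t \in [0,T].$$ (iii) There exists a constant $C$ depending only on the data such that $$\left|\int_{0}^{L} u_x(t,x)m(t,x)\,dx \right| \leq C \quad \forall t \in [0,T].$$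
   Context: Constants: $T>0$, $L>0$, $\sigma>0$, $\epsilon\ge 0$ (competition parameter) and a real constant $r$ (discount rate) are given. The system (S) for $(u,m)$ is $$ \left\{ \begin{array}{ll} u_t + \frac{1}{2}\sigma^2 u_{xx} - ru + H(t,u_x,[mu_x]) = 0, & 0 < t < T, \ 0 < x < L,\\ m_t - \frac{1}{2}\sigma^2 m_{xx} - \left(G(t,u_x,[mu_x])m\right)_x = 0, & 0 < t < T, \ 0 < x < L,\\ m(0,x) = m_0(x),\quad u(T,x) = u_T(x), & 0 \leq x \leq L,\\ u(t,0) = m(t,0) = 0, \quad u_x(t,L) = 0, & 0 \leq t \leq T, \\ \frac{1}{2}\sigma^2 m_x(t,L) + G(t,u_x(t,L),[mu_x])m(t,L) = 0, & 0 \leq t \leq T. \end{array}\right. $$ Nonlocal coefficients: put $\eta(t)=\int_0^L m(t,x)\,dx$, $a(\eta)=\frac{1}{1+\epsilon\eta}$, $c(\eta)=1-a(\eta)=\frac{\epsilon\eta}{1+\epsilon\eta}$, and $$\bar p(t)=\frac{1}{2-c(\eta(t))}\left(a(\eta(t))+\frac{1}{\eta(t)}\int_0^L u_x(t,x)m(t,x)\,dx\right).$$ Then $$H(t,u_x,[mu_x])=\tfrac14\big(a(\eta(t))+c(\eta(t))\bar p(t)-u_x\big)^2,\qquad G(t,u_x,[mu_x])=\tfrac12\big(a(\eta(t))+c(\eta(t))\bar p(t)-u_x\big).$$ Equivalently, $a(\eta(t))+c(\eta(t))\bar p(t)=\frac{2}{2+\epsilon\eta(t)}+\frac{\epsilon}{2+\epsilon\eta(t)}\int_0^L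 u_x(t,x)m(t,x)\,dx$. Standing assumptions on the data: (1) $u_T,m_0\in C^{2+\gamma}([0,L])$ for some $\gamma>0$ (second derivatives Hölder continuous with exponent $\gamma$); (2) $u_T(0)=u_T'(L)=0$ and $m_0(0)=m_0(L)=m_0'(L)=0$; (3) $m_0\ge 0$ and $\int_0^L m_0(x)\,dx=1$; (4) $u_T\ge 0$ and $u_T'\ge 0$. ''Depending only on the data'' means depending only on $u_T,m_0,L,T,\sigma,r,\epsilon$ (and not on the particular solution $(u,m)$). *)

(* Defs.v *)
From Stdlib Require Import Reals.
From Coquelicot Require Import Coquelicot.
Open Scope R_scope.

Definition Icc (a b x : R) : Prop := a <= x <= b.

(** Derivatives on closed intervals are taken within the interval ([D_in]),
    hence one-sided at the endpoints.  Functions are total on [R], but nothing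
    below constrains their values outside the closed interval or rectangle. *)

(** [f] is of class C^{2+gamma} on [[0, L]], with [f1 = f'] and [f2 = f''].
    The case [x = y] is excluded because [Rpower 0 gamma] is not 0. *)
Record C2_holder (L gamma : R) (f f1 f2 : R -> R) : Prop := {
  C2_holder_d1 : forall x, Icc 0 L x -> D_in f f1 (Icc 0 L) x;
  C2_holder_d2 : forall x, Icc 0 L x -> D_in f1 f2 (Icc 0 L) x;
  C2_holder_bound : exists K : R, forall x y,
    Icc 0 L x -> Icc 0 L y -> x <> y ->
    Rabs (f2 x - f2 y) <= K * Rpower (Rabs (x - y)) gamma
}.

Definition admissible_data (L : R) (uT m0 : R -> R) : Prop :=
  exists (gamma : R) (uT1 uT2 m01 m02 : R -> R),
    0 < gamma /\
    C2_holder L gamma uT uT1 uT2 /\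
    C2_holder L gamma m0 m01 m02 /\
    (uT 0 = 0 /\ uT1 L = 0) /\
    (m0 0 = 0 /\ m0 L = 0 /\ m01 L = 0) /\
    (forall x, Icc 0 L x -> 0 <= m0 x) /\
    RInt m0 0 L = 1 /\
    (forall x, Icc 0 L x -> 0 <= uT x) /\
    (forall x, Icc 0 L x -> 0 <= uT1 x).

Definition rect (T L : R) (p : R * R) : Prop :=
  Icc 0 T (fst p) /\ Icc 0 L (snd p).

Definition continuous_on_rect (T L : R) (f : R -> R -> R) : Prop :=
  continuous_on (rect T L) (fun p : R * R => f (fst p) (snd p)).

(** [f] is of class C^{1,2} up to the boundary of [[0, T] x [0, L]] (the first
    argument is time), with partial derivatives [ft], [fx], [fxx]. *)
Record C12 (T L : R) (f ft fx fxx : R -> R -> R) : Prop := {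
  C12_dt : forall t x, Icc 0 T t -> Icc 0 L x ->
    D_in (fun s => f s x) (fun s => ft s x) (Icc 0 T) t;
  C12_dx : forall t x, Icc 0 T t -> Icc 0 L x ->
    D_in (f t) (fx t) (Icc 0 L) x;
  C12_dxx : forall t x, Icc 0 T t -> Icc 0 L x ->
    D_in (fx t) (fxx t) (Icc 0 L) x;
  C12_cont : continuous_on_rect T L f;
  C12_cont_t : continuous_on_rect T L ft;
  C12_cont_x : continuous_on_rect T L fx;
  C12_cont_xx : continuous_on_rect T L fxx
}.

Definition mass (L : R) (m : R -> R -> R) (t : R) : R := RInt (m t) 0 L.

Definition coef_a (eps eta : R) : R := 1 / (1 + eps * eta).

Definition coef_c (eps eta : R) : R := 1 - coef_a eps eta.

(** If the mass vanishes then [coef_c] is 0, so the value given to [1 / 0] does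
    not enter [coef_H] and [coef_G], which only use [coef_c * pbar]. *)
Definition pbar (L eps : R) (ux m : R -> R -> R) (t : R) : R :=
  1 / (2 - coef_c eps (mass L m t)) *
  (coef_a eps (mass L m t) +
   1 / mass L m t * RInt (fun x => ux t x * m t x) 0 L).

Definition coef_H (L eps : R) (ux m : R -> R -> R) (t x : R) : R :=
  1 / 4 * (coef_a eps (mass L m t) +
           coef_c eps (mass L m t) * pbar L eps ux m t - ux t x) ^ 2.

Definition coef_G (L eps : R) (ux m : R -> R -> R) (t x : R) : R :=
  1 / 2 * (coef_a eps (mass L m t) +
           coef_c eps (mass L m t) * pbar L eps ux m t - ux t x).

Record smooth_solution (T L sigma eps r : R) (uT m0 : R -> R)
  (u ut ux uxx m mt mx mxx : R -> R -> R) : Prop := {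
  sol_u_smooth : C12 T L u ut ux uxx;
  sol_m_smooth : C12 T L m mt mx mxx;
  sol_u_eq : forall t x, 0 < t < T -> 0 < x < L ->
    ut t x + 1 / 2 * sigma ^ 2 * uxx t x - r * u t x
      + coef_H L eps ux m t x = 0;
  sol_m_eq : forall t x, 0 < t < T -> 0 < x < L ->
    mt t x - 1 / 2 * sigma ^ 2 * mxx t x
      - Derive (fun y => coef_G L eps ux m t y * m t y) x = 0;
  sol_m_init : forall x, Icc 0 L x -> m 0 x = m0 x;
  sol_u_final : forall x, Icc 0 L x -> u T x = uT x;
  sol_u_left : forall t, Icc 0 T t -> u t 0 = 0;
  sol_m_left : forall t, Icc 0 T t -> m t 0 = 0;
  sol_u_right : forall t, Icc 0 T t -> ux t L = 0;
  sol_m_right : forall t, Icc 0 T t ->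
    1 / 2 * sigma ^ 2 * mx t L + coef_G L eps ux m t L * m t L = 0
}.

(* Main.v *)
Require Import Defs.
From Stdlib Require Import Reals Lra Psatz Classical ClassicalEpsilon.
From Coquelicot Require Import Coquelicot.
Open Scope R_scope.
Set Bullet Behavior "Strict Subproofs".

(** Write [nu = sigma ^ 2 / 2], [w = u_x], [F = a + c pbar], [q = (F - w) / 2],
    [eta] for the mass, and [X] for the energy [RInt (w ^ 2 m)].

    By the maximum principle [m], [u] and [w] are nonnegative and [eta <= 1].  So
    [w m >= 0], and all three claims follow from a bound of [RInt (w m)] over
    [[0, L]] that is uniform in time.

    The two equations are dual to each other: the derivative of
    [exp (- r t) RInt (u m)] equals [exp (- r t) (X - F ^ 2 eta) / 4].  The price
    [F] is a convex combination of 1 and of the average of [w], and the weight of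
    the average stays below 1, so [F ^ 2 eta] cannot compensate [X]
    ([price_sq_mass_le]).  This bounds the time integral of [X], hence that of
    [F ^ 2] ([energy_integral_le]).  Comparison with a function of time alone then
    bounds [u] ([u_le_bound]); testing the equation of [u] with the weight [x]
    bounds the integral of [x q ^ 2] over space and time
    ([hamiltonian_integral_le]), and the entropy of [1 + m] bounds that of
    [m_x ^ 2 / (1 + m)] ([fisher_integral_le]).

    To pass from integrals in time to a bound at every time, differentiate
    [RInt (w m phi)] for [phi = a x ^ 2 + b].  Up to boundary terms and the factor
    [r], the derivative contains [phi'] times [w m_x], [w m] and [q w m] only, and
    these are integrable in space and time by the above, since [phi' = 2 a x]
    ([abs_remainder_le]).  The boundary terms have signs.  For
    [phi = L ^ 2 - x ^ 2] only the one at 0 survives; it decreases the integral,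
    and one integrates forwards from [t = 0], where an integration by parts uses
    the smoothness of [m0] and the bound of [u] ([left_moment_le]).  For
    [phi = x ^ 2] only the one at [L] survives; it increases the integral, and one
    integrates backwards from [t = T], where [w = uT'] ([right_moment_le]).  The two
    weights add up to the constant [L ^ 2].

    As [u] is only of class C^{1,2}, the derivative [w_t] need not exist.  But
    [RInt (w psi)] is differentiable in time for every [psi] of class C^1 in [x],
    because an integration by parts leaves only [u] to be differentiated
    ([is_derive_pairing]); this replaces the equation satisfied by [w] both in the
    proof that [w >= 0] and in the derivative of [RInt (w m phi)]. *)

(** * Continuity of explicit expressions *)

Definition cont2 (f : R -> R -> R) : Prop :=
  forall t x, continuous (fun p : R * R => f (fst p) (snd p)) (t, x).

Lemma continuous_cont2_comp {U : UniformSpace} (f : R -> R -> R) (a b : U -> R) (p : U) :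
  cont2 f -> continuous a p -> continuous b p ->
  continuous (fun z => f (a z) (b z)) p.
Proof.
  intros Hf Ha Hb. apply (continuous_comp_2 a b f p Ha Hb). apply Hf.
Qed.

Section ContRules.
Context {U : UniformSpace}.
Implicit Types f g : U -> R.
Lemma continuous_Rplus f g p :
  continuous f p -> continuous g p -> continuous (fun z => f z + g z) p.
Proof. exact (@continuous_plus U R_AbsRing R_NormedModule f g p). Qed.

Lemma continuous_Rminus f g p :
  continuous f p -> continuous g p -> continuous (fun z => f z - g z) p.
Proof. exact (@continuous_minus U R_AbsRing R_NormedModule f g p). Qed.

Lemma continuous_Ropp f p : continuous f p -> continuous (fun z => - f z) p.
Proof. exact (@continuous_opp U R_AbsRing R_NormedModule f p). Qed.

Lemma continuous_Rmult f g p :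
  continuous f p -> continuous g p -> continuous (fun z => f z * g z) p.
Proof. exact (@continuous_mult U R_AbsRing f g p). Qed.

Lemma continuous_Rpow f n p : continuous f p -> continuous (fun z => f z ^ n) p.
Proof.
  intros H. induction n as [|n IH]; simpl.
  - apply continuous_const.
  - now apply continuous_Rmult.
Qed.

Lemma continuous_pt_comp (h : R -> R) f p :
  continuity_pt h (f p) -> continuous f p -> continuous (fun z => h (f z)) p.
Proof.
  intros Hh Hf. apply (continuous_comp f h p Hf).
  now apply continuity_pt_filterlim.
Qed.

Lemma continuous_Rdiv f g p :
  continuous f p -> continuous g p -> g p <> 0 -> continuous (fun z => f z / g z) p.
Proof.
  intros Hf Hg H0. apply continuous_Rmult; [assumption|].
  apply (continuous_pt_comp Rinv g p); [|assumption].
  apply continuity_pt_inv; [apply continuity_pt_id|exact H0].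
Qed.
End ContRules.

(** * The positive part *)

Definition pospart (x : R) : R := Rmax x 0.

Lemma pospart_ge0 x : 0 <= pospart x.
Proof. apply Rmax_r. Qed.

Lemma pospart_eq0 x : x <= 0 -> pospart x = 0.
Proof. intros; unfold pospart; now apply Rmax_right. Qed.

Lemma pospart_eq x : 0 <= x -> pospart x = x.
Proof. intros; unfold pospart; now apply Rmax_left. Qed.

Lemma mul_pospart x : x * pospart x = pospart x ^ 2.
Proof. destruct (Rle_dec 0 x); [rewrite !pospart_eq by lra|rewrite pospart_eq0 by lra]; ring. Qed.

(** The remainder of the first order expansion of the squared positive part is at
    most [h ^ 2], on either side of the kink. *)
Lemma is_derive_pospart2 x : is_derive (fun y => pospart y ^ 2) x (2 * pospart x).
Proof.
  apply is_derive_Reals. intros e He.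
  exists (mkposreal e He); intros h Hh Hd; simpl in Hd.
  replace ((pospart (x + h) ^ 2 - pospart x ^ 2) / h - 2 * pospart x)
    with ((pospart (x + h) ^ 2 - pospart x ^ 2 - 2 * pospart x * h) / h) by (field; exact Hh).
  assert (Hk : Rabs (pospart (x + h) ^ 2 - pospart x ^ 2 - 2 * pospart x * h) <= h * h).
  { unfold pospart, Rmax; apply Rabs_le.
    destruct (Rle_dec (x + h) 0); destruct (Rle_dec x 0); nra. }
  unfold Rdiv. rewrite Rabs_mult, Rabs_inv.
  assert (0 < Rabs h) by now apply Rabs_pos_lt.
  assert (h * h = Rabs h * Rabs h) by (rewrite <- Rabs_mult, Rabs_pos_eq; nra).
  apply Rle_lt_trans with (Rabs h); [|exact Hd].
  apply Rmult_le_reg_r with (Rabs h); [assumption|].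
  rewrite Rmult_assoc, Rinv_l; lra.
Qed.

Lemma continuity_pospart x : continuity_pt pospart x.
Proof.
  apply continuity_pt_ext with (fun y => (y + Rabs y) / 2).
  - intros y. unfold pospart, Rmax, Rabs. destruct (Rle_dec y 0); destruct (Rcase_abs y); lra.
  - apply continuity_pt_mult; [|apply continuity_pt_const; now intros ? ?].
    apply continuity_pt_plus; [apply continuity_pt_id|apply Rcontinuity_abs].
Qed.

Lemma is_derive_pospart3 x : is_derive (fun y => pospart y ^ 3) x (3 * pospart x ^ 2).
Proof.
  apply (is_derive_ext (fun y => y * pospart y ^ 2)).
  - intros y. change (y * pospart y ^ 2 = pospart y ^ 3).
    replace (pospart y ^ 3) with (pospart y ^ 2 * pospart y) by ring. rewrite <- mul_pospart at 2.
    pose proof (mul_pospart y); nra.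
  - replace (3 * pospart x ^ 2) with (1 * pospart x ^ 2 + x * (2 * pospart x)).
    2:{ pose proof (mul_pospart x); nra. }
    apply (is_derive_mult (fun y => y) (fun y => pospart y ^ 2));
      [apply is_derive_Reals; apply derivable_pt_lim_id|apply is_derive_pospart2|intros; apply Rmult_comm].
Qed.

(** The third power is the lowest one for which the positive part is of class
    C^2 and convex, so that the maximum principle can be proved by differentiating
    [RInt (pospart v ^ 3)]; this tangent inequality takes the place of the chain
    rule when [v] is not differentiable in time. *)
Lemma pospart3_convex a b : 3 * pospart a ^ 2 * (b - a) <= pospart b ^ 3 - pospart a ^ 3.
Proof.
  assert (Hp : pospart a * a = pospart a * pospart a) by (pose proof (mul_pospart a); nra).
  assert (H2 : 3 * pospart a ^ 2 * (b - a) <= 3 * pospart a ^ 2 * (pospart b - pospart a)).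
  { assert (b <= pospart b) by apply Rmax_l. pose proof (pospart_ge0 a). nra. }
  pose proof (pospart_ge0 a); pose proof (pospart_ge0 b).
  assert (0 <= (pospart b - pospart a) ^ 2 * (pospart b + 2 * pospart a)).
  { apply Rmult_le_pos; [apply pow2_ge_0|lra]. }
  nra.
Qed.

(** Applies to functions on [R], on [R * R], and on [(R * R) * R]; the last form
    appears when an integral depends on two parameters. *)
Ltac cont :=
  repeat match goal with
  | |- continuous (fun z => z) _ => apply continuous_id
  | |- continuous (fun z => fst z) _ => apply continuous_fst
  | |- continuous (fun z => snd z) _ => apply continuous_snd
  | |- continuous (fun z => fst (fst z)) _ => apply (continuous_comp fst fst); apply continuous_fst
  | |- continuous (fun z => snd (fst z)) _ =>
      apply (continuous_comp fst snd); [apply continuous_fst|apply continuous_snd]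
  | |- continuous fst _ => apply continuous_fst
  | |- continuous snd _ => apply continuous_snd
  | H : continuous ?f ?x |- continuous ?f ?x => exact H
  | H : cont2 ?f |- continuous (fun z => ?f _ _) _ => apply (continuous_cont2_comp f); [exact H | |]
  | H : cont2 ?f |- continuous (?f ?t) _ =>
      apply (continuous_cont2_comp f (fun _ => t) (fun x => x)); [exact H | |]
  | H : forall t, continuous ?f t |- continuous (fun z => ?f _) _ =>
      apply (continuous_comp _ f); [|exact (H _)]
  | H : forall t, continuous ?f t |- continuous ?f _ => exact (H _)
  | |- continuous (Rmult ?c) ?p => change (continuous (fun z => c * z) p)
  | |- continuous (fun z => _ + _) _ => apply continuous_Rplus
  | |- continuous (fun z => _ - _) _ => apply continuous_Rminus
  | |- continuous (fun z => - _) _ => apply continuous_Ropp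
  | |- continuous (fun z => _ * _) _ => apply continuous_Rmult
  | |- continuous (fun z => _ / _) _ => apply continuous_Rdiv; [| |try lra]
  | |- continuous (fun z => _ ^ _) _ => apply continuous_Rpow
  | |- continuous (fun z => pospart _) _ => apply (continuous_pt_comp pospart); [apply continuity_pospart|]
  | |- continuous (fun z => exp _) _ =>
      apply (continuous_pt_comp exp); [apply derivable_continuous_pt, derivable_pt_exp|]
  | |- continuous (fun z => ln _) _ => apply (continuous_comp _ ln); [|apply continuous_ln]
  | |- continuous (fun z => ?c) _ => simple apply continuous_const
  end.

Ltac cont2_tac := let t := fresh "t" in let x := fresh "x" in
  intros t x; cbn beta; cont.

(** * Differentiation of explicit expressions *)
Lemma is_derive_eq (f : R -> R) (x l l' : R) : is_derive f x l' -> l' = l -> is_derive f x l.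
Proof. now intros H <-. Qed.

Lemma is_derive_Rplus (f g : R -> R) x df dg :
  is_derive f x df -> is_derive g x dg -> is_derive (fun y => f y + g y) x (df + dg).
Proof. exact (@is_derive_plus R_AbsRing R_NormedModule f g x df dg). Qed.

Lemma is_derive_Rminus (f g : R -> R) x df dg :
  is_derive f x df -> is_derive g x dg -> is_derive (fun y => f y - g y) x (df - dg).
Proof. exact (@is_derive_minus R_AbsRing R_NormedModule f g x df dg). Qed.

Lemma is_derive_Ropp (f : R -> R) x df :
  is_derive f x df -> is_derive (fun y => - f y) x (- df).
Proof. exact (@is_derive_opp R_AbsRing R_NormedModule f x df). Qed.

Lemma is_derive_Rmult (f g : R -> R) x df dg :
  is_derive f x df -> is_derive g x dg ->
  is_derive (fun y => f y * g y) x (df * g x + f x * dg).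
Proof.
  intros Hf Hg. apply (is_derive_mult f g x df dg Hf Hg). intros; apply Rmult_comm.
Qed.

Lemma is_derive_Rcomp (h f : R -> R) x df dh :
  is_derive f x df -> is_derive h (f x) dh -> is_derive (fun y => h (f y)) x (df * dh).
Proof. intros Hf Hh. exact (is_derive_comp h f x dh df Hh Hf). Qed.

Lemma is_derive_Rsqr (f : R -> R) x df :
  is_derive f x df -> is_derive (fun y => f y ^ 2) x (2 * f x * df).
Proof.
  intros Hf. replace (2 * f x * df) with (df * (2 * f x)) by ring.
  apply (is_derive_Rcomp (fun z => z ^ 2)); [exact Hf|].
  auto_derive; [exact I|ring].
Qed.

Lemma is_derive_Rid x : is_derive (fun y : R => y) x 1.
Proof. apply (@is_derive_id R_AbsRing). Qed.

Lemma is_derive_Rconst (a x : R) : is_derive (fun _ : R => a) x 0.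
Proof. apply (@is_derive_const R_AbsRing R_NormedModule). Qed.

Lemma is_derive_Rscal (c x : R) : is_derive (fun y => c * y) x c.
Proof.
  apply is_derive_eq with (0 * x + c * 1); [|ring].
  apply is_derive_Rmult; [apply is_derive_Rconst|apply is_derive_Rid].
Qed.

Lemma is_derive_Rdivc (f : R -> R) (c x df : R) :
  is_derive f x df -> is_derive (fun y => f y / c) x (df / c).
Proof.
  intros H. apply is_derive_eq with (df * / c + f x * 0); [|unfold Rdiv; ring].
  apply (is_derive_Rmult f (fun _ => / c)); [exact H|apply is_derive_Rconst].
Qed.

(** An equation between Coquelicot integrals may live in the carrier of a normed
    module, where [ring] does not see the real numbers. *)
Ltac ring_R := match goal with |- ?a = ?b => change (@eq R a b); ring end.

Ltac deriv_step :=
  match goal with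
  | |- is_derive (fun y => y) _ _ => apply is_derive_Rid
  | H : is_derive ?f ?x _ |- is_derive ?f ?x _ => exact H
  | H : forall t, _ -> forall x, is_derive (fun s => ?f s x) t _ |- is_derive (fun s => ?f s _) _ _ => apply H
  | H : forall t, _ -> forall x, is_derive (?f t) x _ |- is_derive (fun s => ?f ?t s) _ _ => apply H
  | H : forall t x, _ -> is_derive (?f t) x _ |- is_derive (fun s => ?f ?t s) _ _ => apply H
  | H : forall t x, _ -> is_derive (?f t) x _ |- is_derive (?f _) _ _ => apply H
  | H : forall t, _ -> is_derive ?f t _ |- is_derive ?f _ _ => apply H
  | H : forall t, _ -> is_derive ?f t _ |- is_derive (fun s => ?f s) _ _ => apply H
  | H : forall t, is_derive ?f t _ |- is_derive (fun s => ?f s) _ _ => apply H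
  | |- is_derive (Rmult ?c) ?p _ => exact (is_derive_Rscal c p)
  | |- is_derive (fun y => _ + _) _ _ => apply is_derive_Rplus
  | |- is_derive (fun y => _ - _) _ _ => apply is_derive_Rminus
  | |- is_derive (fun y => - _) _ _ => apply is_derive_Ropp
  | |- is_derive (fun y => pospart _ ^ 2) _ _ =>
      apply (is_derive_Rcomp (fun z => pospart z ^ 2)); [|apply is_derive_pospart2]
  | |- is_derive (fun y => pospart _ ^ 3) _ _ =>
      apply (is_derive_Rcomp (fun z => pospart z ^ 3)); [|apply is_derive_pospart3]
  | |- is_derive (fun y => _ ^ 2) _ _ => apply is_derive_Rsqr
  | |- is_derive (fun y => exp _) _ _ => apply (is_derive_Rcomp exp); [|apply is_derive_exp]
  | |- is_derive (fun y => ln _) _ _ => apply (is_derive_Rcomp ln); [|apply is_derive_ln]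
  | |- is_derive (fun y => _ / _) _ _ => apply is_derive_Rdivc
  | |- is_derive (fun y => _ * _) _ _ => apply is_derive_Rmult
  | |- is_derive (fun y => ?c) _ _ => simple apply is_derive_Rconst
  end.
(** Leaves the goal that the derivative produced by the rules equals the claimed
    one, after the side conditions that [assumption] does not close. *)
Ltac deriv := eapply is_derive_eq; [repeat (deriv_step; try assumption) | cbn beta].

(** * Integrals of continuous functions *)

Lemma ex_RInt_cont (f : R -> R) a b : (forall x, continuous f x) -> ex_RInt f a b.
Proof. intros H. apply (@ex_RInt_continuous R_CompleteNormedModule). intros; apply H. Qed.

Lemma MVT_open (f f' : R -> R) a b :
  a < b -> (forall x, continuous f x) ->
  (forall x, a < x < b -> is_derive f x (f' x)) ->
  exists c, a < c < b /\ f b - f a = f' c * (b - a).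
Proof.
  intros Hab Hc Hd.
  assert (pr : forall c, a < c < b -> derivable_pt f c).
  { intros c H. exists (f' c). now apply is_derive_Reals, Hd. }
  destruct (MVT f id a b pr (fun c _ => derivable_pt_id c) Hab) as [c [P E]].
  - intros; apply continuity_pt_filterlim, Hc.
  - intros; apply derivable_continuous_pt, derivable_pt_id.
  - exists c; split; [exact P|].
    rewrite (derive_pt_eq_0 _ _ 1 (derivable_pt_id c)) in E by apply derivable_pt_lim_id.
    rewrite (derive_pt_eq_0 _ _ (f' c) (pr c P)) in E by now apply is_derive_Reals, Hd.
    unfold id in E; lra.
Qed.

Lemma nondecreasing_of_derive (f f' : R -> R) a b :
  a <= b -> (forall x, continuous f x) ->
  (forall x, a < x < b -> is_derive f x (f' x)) ->
  (forall x, a < x < b -> 0 <= f' x) -> f a <= f b.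
Proof.
  intros Hab Hc Hd Hp.
  destruct (Req_dec a b) as [->|Hn]; [lra|].
  destruct (MVT_open f f' a b) as [c [P E]]; [lra|assumption..|].
  specialize (Hp c P). nra.
Qed.

Lemma is_derive_RInt_upper (f : R -> R) a x :
  (forall y, continuous f y) -> is_derive (fun b => RInt f a b) x (f x).
Proof.
  intros Hc. apply (@is_derive_RInt R_CompleteNormedModule f (RInt f a) a x).
  - exists (mkposreal 1 Rlt_0_1). intros y _.
    apply (@RInt_correct R_CompleteNormedModule). now apply ex_RInt_cont.
  - apply Hc.
Qed.

Lemma continuous_RInt_upper (f : R -> R) a x :
  (forall y, continuous f y) -> continuous (fun b => RInt f a b) x.
Proof.
  intros Hc. apply (ex_derive_continuous (fun b => RInt f a b)).
  exists (f x). now apply is_derive_RInt_upper.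
Qed.

(** The fundamental theorem of calculus, as an inequality, for a function known
    to be differentiable only inside the interval. *)
Lemma RInt_le_increment (f E E' : R -> R) a b :
  a <= b -> (forall x, continuous f x) -> (forall x, continuous E x) ->
  (forall x, a < x < b -> is_derive E x (E' x)) ->
  (forall x, a < x < b -> f x <= E' x) -> RInt f a b <= E b - E a.
Proof.
  intros Hab Hf HE HD Hle.
  assert (H := nondecreasing_of_derive (fun x => E x - RInt f a x) (fun x => E' x - f x) a b Hab).
  cbn beta in H. rewrite RInt_point in H. change (@zero R_CompleteNormedModule) with 0 in H.
  cut (E a - 0 <= E b - RInt f a b); [lra|]. apply H.
  - intros x; cont. now apply continuous_RInt_upper.
  - intros x Hx. apply is_derive_Rminus; [now apply HD|now apply is_derive_RInt_upper].
  - intros x Hx. specialize (Hle x Hx). lra.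
Qed.

Lemma RInt_plus_cont (f g : R -> R) a b :
  (forall x, continuous f x) -> (forall x, continuous g x) ->
  RInt (fun x => f x + g x) a b = RInt f a b + RInt g a b.
Proof. intros; apply (RInt_plus (V:=R_CompleteNormedModule)); now apply ex_RInt_cont. Qed.

Lemma RInt_scal_cont (f : R -> R) k a b :
  (forall x, continuous f x) -> RInt (fun x => k * f x) a b = k * RInt f a b.
Proof. intros; apply (RInt_scal (V:=R_CompleteNormedModule)); now apply ex_RInt_cont. Qed.

Lemma RInt_le_cont (f g : R -> R) a b :
  a <= b -> (forall x, continuous f x) -> (forall x, continuous g x) ->
  (forall x, a < x < b -> f x <= g x) -> RInt f a b <= RInt g a b.
Proof. intros; apply RInt_le; try assumption; now apply ex_RInt_cont. Qed.

Lemma RInt_eq0 (f : R -> R) a b :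
  a <= b -> (forall x, a < x < b -> f x = 0) -> RInt f a b = 0.
Proof.
  intros Hab Hf. rewrite (RInt_ext _ (fun _ => 0)).
  - rewrite RInt_const. apply Rmult_0_r.
  - rewrite Rmin_left, Rmax_right by exact Hab. exact Hf.
Qed.

Lemma RInt_nonneg_cont (f : R -> R) a b :
  a <= b -> (forall x, continuous f x) -> (forall x, a < x < b -> 0 <= f x) -> 0 <= RInt f a b.
Proof. intros. apply RInt_ge_0; try assumption. now apply ex_RInt_cont. Qed.

Lemma RInt_subinterval_le (f : R -> R) a c d b :
  a <= c -> c <= d -> d <= b -> (forall x, continuous f x) ->
  (forall x, a < x < b -> 0 <= f x) -> RInt f c d <= RInt f a b.
Proof.
  intros Hac Hcd Hdb Hf Hp.
  assert (E1 : RInt f a c + RInt f c b = RInt f a b)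
    by (apply (RInt_Chasles (V:=R_CompleteNormedModule)); now apply ex_RInt_cont).
  assert (E2 : RInt f c d + RInt f d b = RInt f c b)
    by (apply (RInt_Chasles (V:=R_CompleteNormedModule)); now apply ex_RInt_cont).
  assert (0 <= RInt f a c) by (apply RInt_nonneg_cont; try assumption; intros; apply Hp; lra).
  assert (0 <= RInt f d b) by (apply RInt_nonneg_cont; try assumption; intros; apply Hp; lra).
  lra.
Qed.

Lemma RInt_const_R (k a b : R) : RInt (fun _ => k) a b = (b - a) * k.
Proof. exact (RInt_const (V:=R_CompleteNormedModule) a b k). Qed.

(** Every spatial estimate below has this form: the time derivative [f] of a
    density is split into an exact derivative [B'], whose integral is a boundary
    term, and a remainder [g].  Integration by parts thus becomes one pointwise
    identity or inequality. *)
Lemma RInt_le_flux (f g B B' : R -> R) a b :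
  a <= b -> (forall x, continuous f x) -> (forall x, continuous g x) ->
  (forall x, continuous B x) ->
  (forall x, a < x < b -> is_derive B x (B' x)) ->
  (forall x, a < x < b -> f x <= B' x + g x) ->
  RInt f a b <= B b - B a + RInt g a b.
Proof.
  intros Hab Hf Hg HB HD Hle.
  assert (RInt (fun x => f x + (-1) * g x) a b <= B b - B a).
  { apply RInt_le_increment with B'; try assumption.
    - intros x; cont.
    - intros x Hx. specialize (Hle x Hx). lra. }
  rewrite RInt_plus_cont, RInt_scal_cont in H; try assumption; [lra|intros; cont].
Qed.

Lemma RInt_eq_flux (f g B B' : R -> R) a b :
  a <= b -> (forall x, continuous f x) -> (forall x, continuous g x) ->
  (forall x, continuous B x) ->
  (forall x, a < x < b -> is_derive B x (B' x)) ->
  (forall x, a < x < b -> f x = B' x + g x) ->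
  RInt f a b = B b - B a + RInt g a b.
Proof.
  intros Hab Hf Hg HB HD He. apply Rle_antisym.
  - apply RInt_le_flux with B'; try assumption. intros x Hx. rewrite He; lra.
  - assert (RInt (fun x => -1 * f x) a b <= (- B b) - (- B a) + RInt (fun x => -1 * g x) a b).
    { apply (RInt_le_flux _ _ (fun x => - B x) (fun x => - B' x)); try assumption.
      1-3: intros; cont.
      - intros; apply is_derive_Ropp; auto.
      - intros x Hx. rewrite He; lra. }
    rewrite !RInt_scal_cont in H; try assumption. lra.
Qed.

(** * Integrals depending on a parameter *)

(** The tube lemma: continuity at each point of the compact slice over [p0] is
    uniform along the slice. *)
Lemma uniform_near_interval {U : UniformSpace} (f : U -> R -> R) a b (p0 : U) :
  (forall x, continuous (fun z : U * R => f (fst z) (snd z)) (p0, x)) ->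
  forall e, 0 < e ->
  locally p0 (fun p => forall x, a <= x <= b -> Rabs (f p x - f p0 x) < e).
Proof.
  intros Hf e He.
  assert (Hd : forall x, exists d : posreal, forall p y, ball p0 d p -> Rabs (y - x) < d ->
             Rabs (f p y - f p0 x) < e / 2).
  { intros x. destruct (proj1 (filterlim_locally _ _) (Hf x) (mkposreal (e/2) ltac:(lra))) as [d Hd].
    exists d. intros p y Hp Hy. apply (Hd (p, y)). split; [exact Hp|exact Hy]. }
  destruct (choice _ Hd) as [d Hd']; clear Hd.
  destruct (compactness_value_1d a b d) as [d0 H0].
  exists d0. intros p Hp x Hx.
  apply Rnot_le_lt; intros Hc. apply (H0 x Hx). intros [t [Ht [Htx Hdt]]].
  assert (Hpt := Hd' t p x (ball_le p0 d0 (d t) Hdt p Hp) Htx).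
  assert (Hpx := Hd' t p0 x (ball_center p0 (d t)) Htx).
  replace (f p x - f p0 x) with ((f p x - f p0 t) - (f p0 x - f p0 t)) in Hc by ring.
  assert (H := Rabs_triang (f p x - f p0 t) (- (f p0 x - f p0 t))).
  rewrite Rabs_Ropp in H. unfold Rminus at 1 in Hc. lra.
Qed.

(** The parameter ranges over an arbitrary uniform space because the derivative
    of a pairing of two functions taken at two different times has to be jointly
    continuous in both times. *)
Lemma continuous_RInt_param {U : UniformSpace} (f : U -> R -> R) a b (p0 : U) :
  a <= b ->
  (forall p x, continuous (fun z : U * R => f (fst z) (snd z)) (p, x)) ->
  continuous (fun p => RInt (f p) a b) p0.
Proof.
  intros Hab Hf.
  assert (Hs : forall p x, continuous (f p) x).
  { intros p x. apply (continuous_comp_2 (fun _ => p) (fun y => y) f x);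
      [apply continuous_const|apply continuous_id|apply Hf]. }
  apply filterlim_locally. intros [e He].
  set (k := e / (2 * (b - a + 1))).
  assert (Hk : 0 < k) by (apply Rdiv_lt_0_compat; lra).
  generalize (uniform_near_interval f a b p0 (fun x => Hf p0 x) k Hk).
  apply filter_imp. intros p Hp.
  change (Rabs (RInt (f p) a b - RInt (f p0) a b) < e).
  replace (RInt (f p) a b - RInt (f p0) a b) with (RInt (fun x => f p x - f p0 x) a b).
  2:{ apply (RInt_minus (V:=R_CompleteNormedModule)); now apply ex_RInt_cont. }
  apply Rle_lt_trans with ((b - a) * k).
  - apply abs_RInt_le_const; [exact Hab| |].
    + apply ex_RInt_cont. intros x. now apply continuous_Rminus.
    + intros x Hx. now apply Rlt_le, Hp.
  - replace e with (2 * (b - a + 1) * k); [nra|unfold k; field; lra].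
Qed.

Lemma locally_between (a b x : R) : a < x < b -> locally x (fun y => a < y < b).
Proof.
  intros Hx.
  apply (open_and (fun y => a < y) (fun y => y < b)); [apply open_gt|apply open_lt|exact Hx].
Qed.

Lemma derivatives_agree (f g : R -> R) (a b x l l' : R) :
  a < x < b -> (forall y, a < y < b -> f y = g y) ->
  is_derive f x l -> is_derive g x l' -> l = l'.
Proof.
  intros Hx Hfg Hf Hg.
  rewrite <- (is_derive_unique _ _ _ Hf), <- (is_derive_unique _ _ _ Hg).
  apply Derive_ext_loc. apply filter_imp with (2 := locally_between a b x Hx). exact Hfg.
Qed.

Lemma is_derive_RInt_param_cont (f f' : R -> R -> R) a b t0 t1 t :
  t0 < t < t1 -> cont2 f -> cont2 f' ->
  (forall t, t0 < t < t1 -> forall x, is_derive (fun s => f s x) t (f' t x)) ->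
  is_derive (fun s => RInt (f s) a b) t (RInt (f' t) a b).
Proof.
  intros Ht Hf Hf' Hd.
  assert (Hloc := locally_between t0 t1 t Ht).
  replace (RInt (f' t) a b) with (RInt (fun x => Derive (fun s => f s x) t) a b).
  - apply is_derive_RInt_param.
    + apply filter_imp with (2 := Hloc). intros s Hs x _. exists (f' s x). now apply Hd.
    + intros x _. apply continuity_2d_pt_ext_loc with f'.
      * destruct Hloc as [d Hd0]. exists d. intros s y Hs _.
        symmetry. apply is_derive_unique, Hd, Hd0. exact Hs.
      * apply continuity_2d_pt_filterlim, Hf'.
    + apply filter_forall. intros s. apply ex_RInt_cont. intros x; cont.
  - apply RInt_ext. intros x _. now apply is_derive_unique, Hd.
Qed.

(** * Bounds and boundary values *)

(** The radius [d] attached to a point is chosen so small that [d * (1 + |f|) <= 1]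
    there; a positive lower bound of the radii then bounds [f] itself. *)
Lemma bounded_on_rectangle (f : R -> R -> R) T L :
  cont2 f -> exists K, 0 < K /\
    forall t x, 0 <= t <= T -> 0 <= x <= L -> Rabs (f t x) <= K.
Proof.
  intros Hf.
  assert (Hd : forall p : R * R, exists d : posreal, d * (1 + Rabs (f (fst p) (snd p))) <= 1 /\
     forall t x, Rabs (t - fst p) < d -> Rabs (x - snd p) < d ->
       Rabs (f t x - f (fst p) (snd p)) < 1).
  { intros [u v]; simpl.
    destruct (proj1 (filterlim_locally _ _) (Hf u v) (mkposreal 1 Rlt_0_1)) as [d Hd].
    assert (H1 : 0 < / (1 + Rabs (f u v))).
    { apply Rinv_0_lt_compat. pose proof (Rabs_pos (f u v)); lra. }
    exists (mkposreal (Rmin d (/ (1 + Rabs (f u v)))) (Rmin_pos _ _ (cond_pos d) H1)); simpl. split.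
    - apply Rle_trans with (/ (1 + Rabs (f u v)) * (1 + Rabs (f u v))).
      + apply Rmult_le_compat_r; [pose proof (Rabs_pos (f u v)); lra|apply Rmin_r].
      + rewrite Rinv_l; [lra|]. pose proof (Rabs_pos (f u v)); lra.
    - intros t x Ht Hx. apply (Hd (t, x)).
      split; (eapply Rlt_le_trans; [eassumption|apply Rmin_l]). }
  destruct (choice _ Hd) as [d Hd']; clear Hd.
  destruct (compactness_value_2d 0 T 0 L (fun u v => d (u, v))) as [d0 H0].
  assert (0 < d0) by apply cond_pos.
  exists (1 + / d0). split; [pose proof (Rinv_0_lt_compat _ H); lra|].
  intros t x Ht Hx. apply Rnot_lt_le; intros Hc.
  apply (H0 t x Ht Hx). intros [u [v [_ [_ [Hu [Hv Hl]]]]]].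
  destruct (Hd' (u, v)) as [Hb He]; simpl in *.
  specialize (He t x Hu Hv).
  assert (Hf1 : Rabs (f u v) <= / d0).
  { pose proof (Rabs_pos (f u v)).
    apply Rmult_le_reg_l with d0; [assumption|]. rewrite Rinv_r; nra. }
  pose proof (Rabs_triang (f t x - f u v) (f u v)) as Htr.
  replace (f t x - f u v + f u v) with (f t x) in Htr by ring. lra.
Qed.

Lemma le_at_limit_of_open (f g : R -> R) a b :
  a < b -> (forall x, continuous f x) -> (forall x, continuous g x) ->
  (forall x, a < x < b -> f x <= g x) -> forall x, a <= x <= b -> f x <= g x.
Proof.
  intros Hab Hf Hg Hle x Hx. apply Rnot_lt_le; intros Hc.
  assert (Hcont : continuous (fun y => f y - g y) x) by cont.
  destruct (proj1 (filterlim_locally _ _) Hcont (mkposreal (f x - g x) ltac:(lra))) as [d Hd].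
  assert (0 < d) by apply cond_pos.
  assert (Hy : exists y, a < y < b /\ Rabs (y - x) < d).
  { destruct (Rle_dec ((a + b) / 2) x).
    - exists (x - Rmin (d / 2) ((b - a) / 4)).
      pose proof (Rmin_l (d / 2) ((b - a) / 4)). pose proof (Rmin_r (d / 2) ((b - a) / 4)).
      assert (0 < Rmin (d / 2) ((b - a) / 4)) by (apply Rmin_pos; lra).
      split; [lra|apply Rabs_def1; lra].
    - exists (x + Rmin (d / 2) ((b - a) / 4)).
      pose proof (Rmin_l (d / 2) ((b - a) / 4)). pose proof (Rmin_r (d / 2) ((b - a) / 4)).
      assert (0 < Rmin (d / 2) ((b - a) / 4)) by (apply Rmin_pos; lra).
      split; [lra|apply Rabs_def1; lra]. }
  destruct Hy as [y [Hy1 Hy2]].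
  specialize (Hd y Hy2). specialize (Hle y Hy1).
  change (Rabs ((f y - g y) - (f x - g x)) < f x - g x) in Hd.
  apply Rabs_def2 in Hd. lra.
Qed.

Lemma eq0_of_RInt_le0 (f : R -> R) a b :
  a < b -> (forall x, continuous f x) -> (forall x, a < x < b -> 0 <= f x) ->
  RInt f a b <= 0 -> forall x, a < x < b -> f x = 0.
Proof.
  intros Hab Hf Hp H0 x Hx.
  apply Rle_antisym; [|now apply Hp]. apply Rnot_lt_le; intros Hc.
  destruct (proj1 (filterlim_locally _ _) (Hf x) (mkposreal (f x / 2) ltac:(lra))) as [d Hd].
  assert (0 < d) by apply cond_pos.
  set (y := x + Rmin (d / 2) ((b - x) / 2)).
  assert (x < y < b /\ y - x < d).
  { unfold y. pose proof (Rmin_l (d / 2) ((b - x) / 2)). pose proof (Rmin_r (d / 2) ((b - x) / 2)).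
    assert (0 < Rmin (d / 2) ((b - x) / 2)) by (apply Rmin_pos; lra). lra. }
  assert (E1 : RInt f a x + RInt f x b = RInt f a b)
    by (apply (RInt_Chasles (V:=R_CompleteNormedModule)); now apply ex_RInt_cont).
  assert (E2 : RInt f x y + RInt f y b = RInt f x b)
    by (apply (RInt_Chasles (V:=R_CompleteNormedModule)); now apply ex_RInt_cont).
  assert (0 <= RInt f a x) by (apply RInt_nonneg_cont; try assumption; [lra|intros; apply Hp; lra]).
  assert (0 <= RInt f y b) by (apply RInt_nonneg_cont; try assumption; [lra|intros; apply Hp; lra]).
  assert (0 < RInt f x y).
  { apply RInt_gt_0; [lra| |intros; apply Hf].
    intros z Hz. assert (Hz' : Rabs (f z - f x) < f x / 2).
    { apply (Hd z). change (Rabs (z - x) < d). apply Rabs_def1; lra. }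
    apply Rabs_def2 in Hz'. lra. }
  lra.
Qed.

Lemma bounded_on_interval (f : R -> R) T :
  (forall t, continuous f t) -> exists K, 0 < K /\ forall t, 0 <= t <= T -> Rabs (f t) <= K.
Proof.
  intros Hf. destruct (bounded_on_rectangle (fun t _ => f t) T 0) as [K [HK H]].
  - cont2_tac.
  - exists K. split; [exact HK|]. intros t Ht. apply (H t 0); lra.
Qed.

Lemma nonpos_of_RInt_pospart3 (f : R -> R) a b :
  a < b -> (forall x, continuous f x) -> RInt (fun x => pospart (f x) ^ 3) a b <= 0 ->
  forall x, a <= x <= b -> f x <= 0.
Proof.
  intros Hab Hf H. apply le_at_limit_of_open; try assumption.
  - intros; cont.
  - intros x Hx. apply Rnot_lt_le; intros Hc.
    assert (E := eq0_of_RInt_le0 (fun y => pospart (f y) ^ 3) a b Hab ltac:(intros; cont)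
      ltac:(intros; apply pow_le, pospart_ge0) H x Hx).
    cbn beta in E. rewrite pospart_eq in E by lra. assert (0 < f x ^ 3) by now apply pow_lt. lra.
Qed.

(** * Differential inequalities *)

(** Parabolic problems with terminal data are solved backwards in time, so the
    comparison with zero starts from the final time. *)
Lemma gronwall_backward (g g' : R -> R) K T :
  (forall t, continuous g t) ->
  (forall t, 0 < t < T -> is_derive g t (g' t)) ->
  (forall t, 0 < t < T -> - K * g t <= g' t) ->
  g T <= 0 -> forall t, 0 <= t <= T -> g t <= 0.
Proof.
  intros Hc Hd Hi HT t Ht.
  assert (H : exp (K * t) * g t <= exp (K * T) * g T).
  { apply (nondecreasing_of_derive (fun s => exp (K * s) * g s)
             (fun s => exp (K * s) * (K * g s + g' s))); [lra| | |].
    - intros s; cont.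
    - intros s Hs. assert (Hds := Hd s ltac:(lra)).
      deriv; ring.
    - intros s Hs. apply Rmult_le_pos; [apply Rlt_le, exp_pos|].
      specialize (Hi s ltac:(lra)). lra. }
  pose proof (exp_pos (K * t)). pose proof (exp_pos (K * T)).
  apply Rnot_lt_le; intros Hn.
  assert (0 < exp (K * t) * g t) by now apply Rmult_lt_0_compat.
  nra.
Qed.

(** The differential inequality is assumed only where [g] is small.  This is
    enough: a function starting at a nonpositive value would have to cross a small
    positive level, and from the last time it does so it could not grow. *)
Lemma gronwall_threshold (g g' : R -> R) K T theta :
  0 < theta -> (forall t, continuous g t) ->
  (forall t, 0 < t < T -> is_derive g t (g' t)) ->
  (forall t, 0 < t < T -> 0 < g t < theta -> g' t <= K * g t) ->
  g 0 <= 0 -> forall t, 0 <= t <= T -> g t <= 0.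
Proof.
  intros Hth Hc Hd Hi H0 t1 Ht1. apply Rnot_lt_le; intros Hpos.
  set (h := fun t => exp (- K * t) * g t).
  assert (Hhc : forall t, continuous h t) by (intros t; unfold h; cont).
  assert (Hh1 : 0 < h t1) by (apply Rmult_lt_0_compat; [apply exp_pos|assumption]).
  assert (HhE : forall t, g t = exp (K * t) * h t).
  { intros t. unfold h. rewrite <- Rmult_assoc, <- exp_plus.
    replace (K * t + - K * t) with 0 by ring. rewrite exp_0; ring. }
  set (M := exp (Rabs K * T)).
  assert (HM : 0 < M) by apply exp_pos.
  assert (HeM : forall t, 0 <= t <= T -> exp (K * t) <= M).
  { intros t Ht. unfold M. destruct (Req_dec (K * t) (Rabs K * T)) as [->|Hn]; [lra|].
    apply Rlt_le, exp_increasing. pose proof (Rle_abs K). pose proof (Rabs_pos K). nra. }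
  (* below [h t1], and so low that [h < 2 * c] keeps [g] under the threshold *)
  set (c := Rmin (h t1) (theta / M) / 2).
  assert (Hc0 : 0 < Rmin (h t1) (theta / M)).
  { apply Rmin_pos; [assumption|now apply Rdiv_lt_0_compat]. }
  assert (Hcl := Rmin_l (h t1) (theta / M)). assert (Hcr := Rmin_r (h t1) (theta / M)).
  assert (Hcpos : 0 < c) by (unfold c; lra).
  set (E := fun s => 0 <= s <= t1 /\ h s <= c).
  assert (HE0 : E 0).
  { split; [lra|]. unfold h, c. rewrite Rmult_0_r, exp_0. lra. }
  destruct (completeness E) as [s [Hub Hlub]].
  { exists t1. intros x [Hx _]; lra. }
  { exists 0; exact HE0. }
  assert (Hs0 : 0 <= s) by (apply Hub, HE0).
  assert (Hs1 : s <= t1) by (apply Hlub; intros x [Hx _]; lra).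
  assert (Hsc : h s <= c).
  { apply Rnot_lt_le; intros Hn.
    destruct (proj1 (filterlim_locally _ _) (Hhc s) (mkposreal (h s - c) ltac:(lra))) as [d Hdd].
    assert (Hdp := cond_pos d).
    assert (s <= s - d / 2); [|simpl in *; lra]. apply Hlub. intros x Hx. assert (x <= s) by now apply Hub.
    apply Rnot_lt_le; intros Hxs. destruct Hx as [_ Hx].
    assert (Hb : Rabs (h x - h s) < h s - c)
      by (apply (Hdd x); change (Rabs (x - s) < d); apply Rabs_def1; lra).
    apply Rabs_def2 in Hb; lra. }
  assert (Hst : s < t1).
  { destruct (Req_dec s t1) as [E1|]; [|lra]. rewrite E1 in Hsc. unfold c in Hsc. lra. }
  assert (Hab : forall x, s < x <= t1 -> c < h x).
  { intros x Hx. apply Rnot_le_lt; intros Hn. assert (x <= s); [|lra]. apply Hub. split; [lra|exact Hn]. }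
  destruct (proj1 (filterlim_locally _ _) (Hhc s) (mkposreal c Hcpos)) as [d Hdd].
  assert (Hdp := cond_pos d).
  set (b := Rmin (s + d / 2) t1).
  assert (Hb1 : b <= s + d / 2) by apply Rmin_l. assert (Hb2 : b <= t1) by apply Rmin_r.
  assert (Hb3 : s < b) by (unfold b; apply Rmin_glb_lt; lra).
  assert (Hdec : - h s <= - h b).
  { apply (nondecreasing_of_derive (fun x => - h x)
       (fun x => exp (- K * x) * (K * g x - g' x))); [lra|intros; cont| |].
    - intros x Hx. assert (Hdx := Hd x ltac:(lra)). unfold h.
      deriv; ring.
    - intros x Hx. apply Rmult_le_pos; [apply Rlt_le, exp_pos|].
      assert (Hhx : c < h x) by (apply Hab; lra).
      assert (Hh2 : Rabs (h x - h s) < c) by (apply (Hdd x); change (Rabs (x - s) < d); apply Rabs_def1; lra).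
      apply Rabs_def2 in Hh2.
      assert (g' x <= K * g x); [|lra]. apply Hi; [lra|].
      rewrite HhE. split.
      + apply Rmult_lt_0_compat; [apply exp_pos|unfold c in Hhx; lra].
      + apply Rlt_le_trans with (M * (theta / M)); [|right; field; lra].
        assert (exp (K * x) <= M) by (apply HeM; lra). pose proof (exp_pos (K * x)).
        apply Rle_lt_trans with (M * h x); [apply Rmult_le_compat_r; unfold c in *; lra|].
        apply Rmult_lt_compat_l; unfold c in *; lra. }
  assert (c < h b) by (apply Hab; lra). lra.
Qed.

(** * Derivatives at an endpoint and along a diagonal *)

Lemma derive_left_nonneg (f f' : R -> R) L :
  0 < L -> (forall x, continuous f x) -> (forall x, continuous f' x) ->
  (forall x, 0 < x < L -> is_derive f x (f' x)) ->
  (forall x, 0 < x < L -> 0 <= f x) -> f 0 = 0 -> 0 <= f' 0.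
Proof.
  intros HL Hf Hf' Hd Hp H0. apply Rnot_lt_le; intros Hn.
  destruct (proj1 (filterlim_locally _ _) (Hf' 0) (mkposreal (- f' 0) ltac:(lra))) as [d Hdd].
  assert (Hdp := cond_pos d).
  set (b := Rmin (d / 2) (L / 2)).
  assert (b <= d / 2) by apply Rmin_l. assert (b <= L / 2) by apply Rmin_r.
  assert (0 < b) by (apply Rmin_pos; lra).
  destruct (MVT_open f f' 0 b) as [c [Hc E]]; [assumption|assumption|intros; apply Hd; lra|].
  assert (Hb : Rabs (f' c - f' 0) < - f' 0).
  { apply (Hdd c). change (Rabs (c - 0) < d). apply Rabs_def1; lra. }
  apply Rabs_def2 in Hb. specialize (Hp b ltac:(lra)). rewrite H0 in E. nra.
Qed.

Lemma derive_right_nonpos (f f' : R -> R) L :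
  0 < L -> (forall x, continuous f x) -> (forall x, continuous f' x) ->
  (forall x, 0 < x < L -> is_derive f x (f' x)) ->
  (forall x, 0 < x < L -> 0 <= f x) -> f L = 0 -> f' L <= 0.
Proof.
  intros HL Hf Hf' Hd Hp H0.
  assert (0 <= - f' (L - 0)); [|rewrite Rminus_0_r in *; lra].
  apply (derive_left_nonneg (fun x => f (L - x)) (fun x => - f' (L - x)) L HL).
  - intros x. apply (continuous_comp (fun x => L - x) f); [cont|apply Hf].
  - intros x. apply continuous_Ropp. apply (continuous_comp (fun x => L - x) f'); [cont|apply Hf'].
  - intros x Hx. apply is_derive_eq with ((0 - 1) * f' (L - x)); [|ring].
    apply (is_derive_Rcomp f (fun x => L - x)); [|apply Hd; lra].
    apply is_derive_Rminus; [apply is_derive_Rconst|apply is_derive_Rid].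
  - intros x Hx. apply Hp. lra.
  - now rewrite Rminus_0_r.
Qed.

(** If the increments of [g] are squeezed between those of [P] in its first
    variable, with the second one frozen at either end, then [g] is differentiable
    although [P] need not be so in its second variable.  For a convex [j] this
    yields the derivative of [RInt (j w)] from the pairings
    [P t s = RInt (w t * j' (w s))]. *)
Lemma is_derive_of_partial_squeeze (g : R -> R) (P P1 : R -> R -> R) t0 t1 t :
  t0 < t < t1 -> cont2 P1 ->
  (forall s tau, t0 < tau < t1 -> is_derive (fun z => P z s) tau (P1 tau s)) ->
  (forall a b, t0 < a < t1 -> t0 < b < t1 ->
     P b a - P a a <= g b - g a <= P b b - P a b) ->
  is_derive g t (P1 t t).
Proof.
  intros Ht Hc Hd Hs. apply is_derive_Reals. intros e He.
  destruct (proj1 (filterlim_locally _ _) (Hc t t) (mkposreal e He)) as [d Hdd].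
  assert (Hm : 0 < Rmin d (Rmin (t - t0) (t1 - t))) by (repeat apply Rmin_pos; try apply cond_pos; lra).
  exists (mkposreal _ Hm). intros h Hh Hhd. simpl in Hhd.
  assert (H1 := Rmin_l d (Rmin (t - t0) (t1 - t))). assert (H2 := Rmin_r d (Rmin (t - t0) (t1 - t))).
  assert (H3 := Rmin_l (t - t0) (t1 - t)). assert (H4 := Rmin_r (t - t0) (t1 - t)).
  assert (H5 := Rabs_def2 _ _ Hhd).
  assert (Hmv : forall s, Rabs (s - t) < d ->
    exists k, P (t + h) s - P t s = k * h /\ Rabs (k - P1 t t) < e).
  { intros s Hst.
    destruct (MVT_gen (fun z => P z s) t (t + h) (fun z => P1 z s)) as [c [Hcc E]].
    - intros z Hz. apply Hd. revert Hz. unfold Rmin, Rmax. destruct Rle_dec; lra.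
    - intros z Hz. apply continuity_pt_filterlim.
      apply (ex_derive_continuous (fun z => P z s)). exists (P1 z s). apply Hd.
      revert Hz. unfold Rmin, Rmax. destruct Rle_dec; lra.
    - exists (P1 c s). split; [rewrite E; f_equal; ring|].
      apply (Hdd (c, s)). split; [|exact Hst]. change (Rabs (c - t) < d).
      apply Rabs_def1; revert Hcc; unfold Rmin, Rmax; destruct Rle_dec; lra. }
  destruct (Hmv t) as [k1 [E1 K1]]; [rewrite Rminus_diag, Rabs_R0; apply cond_pos|].
  destruct (Hmv (t + h)) as [k2 [E2 K2]]; [apply Rabs_def1; lra|].
  destruct (Hs t (t + h)) as [L1 L2]; [lra|lra|].
  rewrite E1 in L1. rewrite E2 in L2.
  apply Rabs_def2 in K1. apply Rabs_def2 in K2.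
  set (Q := (g (t + h) - g t) / h).
  assert (EQ : g (t + h) - g t = Q * h) by (unfold Q; field; exact Hh).
  rewrite EQ in L1, L2.
  assert (k1 <= Q <= k2 \/ k2 <= Q <= k1).
  { destruct (Rlt_dec 0 h); [left|right]; split; nra. }
  apply Rabs_def1; lra.
Qed.

(** Meant for an integrand whose factors are taken at different times. *)
Lemma is_derive_diagonal (P P1 : R -> R -> R) (t dP2 : R) :
  locally t (fun tau => forall s, is_derive (fun z => P z s) tau (P1 tau s)) ->
  is_derive (P t) t dP2 -> continuous (fun p : R * R => P1 (fst p) (snd p)) (t, t) ->
  is_derive (fun z => P z z) t (P1 t t + dP2).
Proof.
  intros H1 H2 H3.
  assert (H : filterdiff (fun p : R * R => P (fst p) (snd p)) (locally (t, t))
     (fun p : R * R => plus (scal (fst p) (P1 t t)) (scal (snd p) dP2))).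
  { apply is_derive_filterdiff; [|exact H2|exact H3].
    destruct H1 as [d Hd]. exists d. intros [a b] [Ha _]. exact (Hd a Ha b). }
  apply filterdiff_ext_lin with (fun y : R => plus (scal y (P1 t t)) (scal y dP2)).
  - apply (filterdiff_comp'_2 (fun z : R => z) (fun z : R => z) P t (fun z => z) (fun z => z)
      (fun a b : R => plus (scal a (P1 t t)) (scal b dP2))); [apply filterdiff_id..|exact H].
  - intros y. symmetry. apply (Rmult_plus_distr_l y).
Qed.

(** * Extension of a solution to the whole plane *)

Definition clamp (b x : R) : R := Rmax 0 (Rmin b x).

Lemma clamp_in b x : 0 <= b -> 0 <= clamp b x <= b.
Proof. intros. unfold clamp, Rmax, Rmin. repeat destruct Rle_dec; lra. Qed.

Lemma clamp_id b x : 0 <= x <= b -> clamp b x = x.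
Proof. intros. unfold clamp, Rmax, Rmin. repeat destruct Rle_dec; lra. Qed.

Lemma clamp_idem b x : 0 <= b -> clamp b (clamp b x) = clamp b x.
Proof. intros. now apply clamp_id, clamp_in. Qed.

Lemma clamp_dist b x y : Rabs (clamp b x - clamp b y) <= Rabs (x - y).
Proof.
  unfold clamp, Rmax, Rmin, Rabs.
  repeat (destruct Rle_dec || destruct Rcase_abs); lra.
Qed.

Definition extend (T L : R) (f : R -> R -> R) (t x : R) : R :=
  f (clamp T t) (clamp L x).

(** [clamp] does not increase distances and has its values in the rectangle, so
    it turns continuity within the rectangle into continuity on the plane. *)
Lemma cont2_extend T L f :
  0 <= T -> 0 <= L -> continuous_on_rect T L f ->
  cont2 (extend T L f).
Proof.
  intros HT HL Hf t x. unfold extend. cbn beta.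
  assert (Hp : rect T L (clamp T t, clamp L x)) by (split; now apply clamp_in).
  specialize (Hf _ Hp). cbn [fst snd] in Hf.
  intros P HP. specialize (Hf P HP). destruct Hf as [d Hd].
  exists d. intros [s y] [Hs Hy]. unfold within in Hd.
  apply (Hd (clamp T s, clamp L y)); [split|split; now apply clamp_in];
    (eapply Rle_lt_trans; [apply clamp_dist|]); assumption.
Qed.

Lemma is_derive_of_D_in (f d : R -> R) (a b x : R) :
  D_in f d (Icc a b) x -> a < x < b -> is_derive f x (d x).
Proof.
  intros HD Hx. apply is_derive_Reals. intros e He.
  destruct (HD e He) as [al [Hal H]].
  assert (Hm : 0 < Rmin al (Rmin (x - a) (b - x))) by (repeat apply Rmin_pos; lra).
  exists (mkposreal _ Hm). intros h Hh Hhd. simpl in Hhd.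
  assert (H1 := Rmin_l al (Rmin (x - a) (b - x))). assert (H2 := Rmin_r al (Rmin (x - a) (b - x))).
  assert (H3 := Rmin_l (x - a) (b - x)). assert (H4 := Rmin_r (x - a) (b - x)).
  assert (H5 := Rabs_def2 _ _ Hhd).
  specialize (H (x + h)). unfold R_met, dist in H; simpl in H. unfold R_dist, Rdist in H.
  replace (x + h - x) with h in H by ring. apply H. split; [|lra].
  split; [unfold Icc; lra|lra].
Qed.

Lemma is_derive_clamp (f : R -> R) (b x l : R) :
  0 < x < b -> is_derive f x l -> is_derive (fun y => f (clamp b y)) x l.
Proof.
  intros Hx. apply is_derive_ext_loc.
  apply filter_imp with (fun y => 0 < y < b).
  - intros y Hy. rewrite clamp_id; [reflexivity|lra].
  - now apply locally_between.
Qed.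

Definition price (L eps : R) (w m : R -> R -> R) (t : R) : R :=
  coef_a eps (mass L m t) + coef_c eps (mass L m t) * pbar L eps w m t.

(** A solution frozen outside the rectangle at its nearest boundary values, so
    that all functions are continuous on the whole plane and differentiable, in the
    usual two-sided sense, over the open intervals.  The equations are written out
    with [nu = sigma ^ 2 / 2] and [w] the space derivative of [u]; the three clamp
    fields carry sign conditions from the rectangle to the plane. *)
Record plane_solution (T L nu eps r : R) (uT m0 : R -> R)
  (u ut w wx m mt mx mxx : R -> R -> R) : Prop := {
  pl_T : 0 < T; pl_L : 0 < L; pl_nu : 0 < nu; pl_eps : 0 <= eps;
  pl_cu : cont2 u; pl_cut : cont2 ut; pl_cw : cont2 w; pl_cwx : cont2 wx;
  pl_cm : cont2 m; pl_cmt : cont2 mt; pl_cmx : cont2 mx; pl_cmxx : cont2 mxx;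
  pl_clamp_u : forall t x, u t x = u (clamp T t) (clamp L x);
  pl_clamp_w : forall t x, w t x = w (clamp T t) (clamp L x);
  pl_clamp_m : forall t x, m t x = m (clamp T t) (clamp L x);
  pl_du_t : forall t, 0 < t < T -> forall x, is_derive (fun s => u s x) t (ut t x);
  pl_dm_t : forall t, 0 < t < T -> forall x, is_derive (fun s => m s x) t (mt t x);
  pl_du_x : forall t x, 0 < x < L -> is_derive (u t) x (w t x);
  pl_dw_x : forall t x, 0 < x < L -> is_derive (w t) x (wx t x);
  pl_dm_x : forall t x, 0 < x < L -> is_derive (m t) x (mx t x);
  pl_dmx_x : forall t x, 0 < x < L -> is_derive (mx t) x (mxx t x);
  pl_u_eq : forall t x, 0 < t < T -> 0 < x < L ->
    ut t x = - nu * wx t x + r * u t x - (price L eps w m t - w t x) ^ 2 / 4;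
  pl_m_eq : forall t x, 0 < t < T -> 0 < x < L ->
    mt t x = nu * mxx t x + (price L eps w m t - w t x) / 2 * mx t x - wx t x / 2 * m t x;
  pl_u_left : forall t, u t 0 = 0;
  pl_m_left : forall t, m t 0 = 0;
  pl_w_right : forall t, w t L = 0;
  pl_m_right : forall t, 0 <= t <= T -> nu * mx t L + price L eps w m t / 2 * m t L = 0;
  pl_m_init : forall x, 0 <= x <= L -> m 0 x = m0 x;
  pl_u_final : forall x, 0 <= x <= L -> u T x = uT x
}.

Lemma price_extend T L eps w m t :
  0 <= L -> 0 <= t <= T ->
  price L eps (extend T L w) (extend T L m) t = price L eps w m t.
Proof.
  intros HL Ht.
  assert (Hm : mass L (extend T L m) t = mass L m t).
  { unfold mass, extend. apply RInt_ext. rewrite Rmin_left, Rmax_right by assumption. intros x Hx.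
    now rewrite !clamp_id by lra. }
  unfold price, pbar. rewrite Hm. unfold extend.
  replace (RInt (fun x => w (clamp T t) (clamp L x) * m (clamp T t) (clamp L x)) 0 L)
    with (RInt (fun x => w t x * m t x) 0 L); [reflexivity|].
  apply RInt_ext. rewrite Rmin_left, Rmax_right by assumption. intros x Hx.
  now rewrite !clamp_id by lra.
Qed.

Lemma plane_solution_of_smooth T L sigma eps r uT m0 u ut ux uxx m mt mx mxx :
  0 < T -> 0 < L -> 0 < sigma -> 0 <= eps ->
  smooth_solution T L sigma eps r uT m0 u ut ux uxx m mt mx mxx ->
  plane_solution T L (1 / 2 * sigma ^ 2) eps r uT m0
    (extend T L u) (extend T L ut) (extend T L ux) (extend T L uxx)
    (extend T L m) (extend T L mt) (extend T L mx) (extend T L mxx).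
Proof.
  intros HT HL Hs He [[Du1 Du2 Du3 Cu Cut Cux Cuxx] [Dm1 Dm2 Dm3 Cm Cmt Cmx Cmxx]
    Eu Em Hm0 HuT Hul Hml Hur Hmr].
  assert (HTc : forall t, Icc 0 T (clamp T t)) by (intros; apply clamp_in; lra).
  assert (HLc : forall x, Icc 0 L (clamp L x)) by (intros; apply clamp_in; lra).
  assert (HI : forall a b x : R, a < x < b -> Icc a b x) by (unfold Icc; intros; lra).
  split; try assumption.
  - nra.
  - apply cont2_extend; [lra|lra|assumption].
  - apply cont2_extend; [lra|lra|assumption].
  - apply cont2_extend; [lra|lra|assumption].
  - apply cont2_extend; [lra|lra|assumption].
  - apply cont2_extend; [lra|lra|assumption].
  - apply cont2_extend; [lra|lra|assumption].
  - apply cont2_extend; [lra|lra|assumption].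
  - apply cont2_extend; [lra|lra|assumption].
  - intros t x. unfold extend. now rewrite !clamp_idem by lra.
  - intros t x. unfold extend. now rewrite !clamp_idem by lra.
  - intros t x. unfold extend. now rewrite !clamp_idem by lra.
  - intros t Ht x. unfold extend. rewrite (clamp_id T t) by lra.
    apply (is_derive_clamp (fun s => u s (clamp L x))); [exact Ht|].
    apply (is_derive_of_D_in (fun s => u s (clamp L x)) (fun s => ut s (clamp L x)) 0 T); auto.
  - intros t Ht x. unfold extend. rewrite (clamp_id T t) by lra.
    apply (is_derive_clamp (fun s => m s (clamp L x))); [exact Ht|].
    apply (is_derive_of_D_in (fun s => m s (clamp L x)) (fun s => mt s (clamp L x)) 0 T); auto.
  - intros t x Hx. unfold extend. rewrite (clamp_id L x) by lra.
    apply is_derive_clamp; [exact Hx|]. apply is_derive_of_D_in with 0 L; auto.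
  - intros t x Hx. unfold extend. rewrite (clamp_id L x) by lra.
    apply is_derive_clamp; [exact Hx|]. apply is_derive_of_D_in with 0 L; auto.
  - intros t x Hx. unfold extend. rewrite (clamp_id L x) by lra.
    apply is_derive_clamp; [exact Hx|]. apply is_derive_of_D_in with 0 L; auto.
  - intros t x Hx. unfold extend. rewrite (clamp_id L x) by lra.
    apply is_derive_clamp; [exact Hx|]. apply is_derive_of_D_in with 0 L; auto.
  - intros t x Ht Hx. rewrite price_extend by lra. unfold extend. rewrite !clamp_id by lra.
    specialize (Eu t x Ht Hx). unfold coef_H in Eu. fold (price L eps ux m t) in Eu. lra.
  - intros t x Ht Hx. rewrite price_extend by lra. unfold extend. rewrite !clamp_id by lra.
    specialize (Em t x Ht Hx).
    replace (Derive (fun y => coef_G L eps ux m t y * m t y) x)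
      with ((price L eps ux m t - ux t x) / 2 * mx t x - uxx t x / 2 * m t x) in Em; [lra|].
    symmetry. apply is_derive_unique.
    assert (D1 : is_derive (m t) x (mx t x)) by (apply is_derive_of_D_in with 0 L; auto).
    assert (D2 : is_derive (ux t) x (uxx t x)) by (apply is_derive_of_D_in with 0 L; auto).
    unfold coef_G. fold (price L eps ux m t). deriv. field.
  - intros t. unfold extend. rewrite (clamp_id L 0) by lra. auto.
  - intros t. unfold extend. rewrite (clamp_id L 0) by lra. auto.
  - intros t. unfold extend. rewrite (clamp_id L L) by lra. auto.
  - intros t Ht. rewrite price_extend by lra. unfold extend. rewrite !clamp_id by lra.
    specialize (Hmr t Ht). unfold coef_G in Hmr. fold (price L eps ux m t) in Hmr.
    rewrite Hur in Hmr by exact Ht. lra.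
  - intros x Hx. unfold extend. rewrite !clamp_id by lra. auto.
  - intros x Hx. unfold extend. rewrite !clamp_id by lra. auto.
Qed.

(** * Price, mass and positivity of the density *)

Ltac open_solution S :=
  destruct S as [hT hL hnu heps cu cut cw cwx cm cmt cmx cmxx ku kw km dut dmt dux dwx dmx dmxx
    equ eqm ul ml wr mr mi uf].

(** For the density, whose sign is not yet known, the denominators [1 + eps * eta]
    and [2 + eps * eta] are kept away from 0 by this lower bound on [eps * eta]. *)
Lemma abs_price_le L eps w m t :
  0 <= eps -> -1 / 2 <= eps * mass L m t ->
  Rabs (price L eps w m t) <= 2 + eps * Rabs (RInt (fun x => w t x * m t x) 0 L).
Proof.
  intros He Hm. unfold price, pbar. set (I := RInt _ 0 L). set (eta := mass L m t) in *.
  assert (0 <= eps * Rabs I) by (apply Rmult_le_pos; [exact He|apply Rabs_pos]).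
  destruct (Req_dec eta 0) as [E|E].
  - unfold coef_c, coef_a. rewrite E, Rmult_0_r.
    replace (1 / (1 + 0)) with 1 by field.
    rewrite Rminus_diag, Rmult_0_l, Rplus_0_r, Rabs_R1. lra.
  - replace (_ + _) with ((2 + eps * I) / (2 + eps * eta)).
    2:{ unfold coef_c, coef_a. field. repeat split; lra. }
    unfold Rdiv. rewrite Rabs_mult, (Rabs_pos_eq (/ _)) by (apply Rlt_le, Rinv_0_lt_compat; lra).
    assert (/ (2 + eps * eta) <= 1) by (rewrite <- Rinv_1; apply Rinv_le_contravar; lra).
    assert (0 < / (2 + eps * eta)) by (apply Rinv_0_lt_compat; lra).
    assert (Rabs (2 + eps * I) <= 2 + eps * Rabs I).
    { eapply Rle_trans; [apply Rabs_triang|]. rewrite Rabs_mult, (Rabs_pos_eq 2), (Rabs_pos_eq eps); lra. }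
    pose proof (Rabs_pos (2 + eps * I)). nra.
Qed.

Section Estimates.
Context {T L nu eps r : R} {uT m0 : R -> R} {u ut w wx m mt mx mxx : R -> R -> R}.
Context (S : plane_solution T L nu eps r uT m0 u ut w wx m mt mx mxx).

Definition revenue t := RInt (fun x => w t x * m t x) 0 L.

Notation F := (price L eps w m).
Notation eta := (mass L m).

Lemma continuous_mass t : continuous eta t.
Proof.
  open_solution S. apply continuous_RInt_param; [lra|]. intros p x; cont.
Qed.

Lemma continuous_revenue t : continuous revenue t.
Proof.
  open_solution S. apply continuous_RInt_param; [lra|]. intros p x; cont.
Qed.

Context {uT1 : R -> R}.
Context (m0_nonneg : forall x, 0 <= x <= L -> 0 <= m0 x).
Context (m0_mass : RInt m0 0 L = 1).
Context (uT_nonneg : forall x, 0 <= x <= L -> 0 <= uT x).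
Context (uT_derive : forall x, 0 < x < L -> is_derive uT x (uT1 x)).
Context (uT1_nonneg : forall x, 0 < x < L -> 0 <= uT1 x).

(** The integral [g] of [pospart (- m) ^ 3] satisfies [g' <= K g], since the flux
    vanishes at [L] and [pospart (- m)] at 0.  The constant [K] involves the price,
    which can be bounded only while the mass is not too negative, that is while [g]
    is below a threshold; hence the form of Gronwall's inequality that is used. *)
Lemma m_nonneg_rect t x : 0 <= t <= T -> 0 <= x <= L -> 0 <= m t x.
Proof.
  intros Ht Hx.
  pose proof continuous_revenue as cI.
  open_solution S.
  destruct (bounded_on_interval _ T cI) as [KI [HKI HI]].
  destruct (bounded_on_rectangle w T L cw) as [Kw [HKw Hw]].
  set (Q := (2 + eps * KI + Kw) / 2).
  (* [pospart y <= k + pospart y ^ 3 / k ^ 2], so a small [g] keeps [eps * eta]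
     above -1/2; [k] and [theta] let each of the two terms contribute 1/4 *)
  set (k := 1 / (4 * (eps + 1) * L)).
  assert (Hk : 0 < k) by (apply Rdiv_lt_0_compat; [lra|repeat apply Rmult_lt_0_compat; lra]).
  assert (HkL : k * L * (eps + 1) = 1 / 4) by (unfold k; field; lra).
  set (theta := k ^ 2 / (4 * (eps + 1))).
  assert (Hk2 : 0 < k ^ 2) by now apply pow_lt.
  assert (Hth : 0 < theta) by (apply Rdiv_lt_0_compat; lra).
  set (g := fun t => RInt (fun x => pospart (- m t x) ^ 3) 0 L).
  assert (Hg : g t <= 0).
  2:{ assert (- m t x <= 0); [|lra].
      apply (nonpos_of_RInt_pospart3 (fun x => - m t x) 0 L); try assumption. intros; cont. }
  apply (gronwall_threshold g (fun t => RInt (fun x => - 3 * pospart (- m t x) ^ 2 * mt t x) 0 L)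
    (3 / (2 * nu) * Q ^ 2) T theta Hth); try assumption.
  - intros s. apply continuous_RInt_param; [lra|]. intros; cont.
  - intros s Hs. apply (is_derive_RInt_param_cont (fun t x => pospart (- m t x) ^ 3)
      (fun t x => - 3 * pospart (- m t x) ^ 2 * mt t x) 0 L 0 T s Hs).
    + cont2_tac.
    + cont2_tac.
    + intros s' Hs' y. cbn beta. deriv; ring.
  - clear t Ht x Hx. intros t Ht [_ Hgt].
    assert (Heta : -1 / 2 <= eps * eta t).
    { assert (- (k * L + / k ^ 2 * g t) <= eta t).
      { assert (HI2 : RInt (fun x => -1 * (k + / k ^ 2 * pospart (- m t x) ^ 3)) 0 L <= eta t).
        2:{ rewrite RInt_scal_cont, RInt_plus_cont, RInt_scal_cont, RInt_const in HI2
              by (intros; cont).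
            change (scal (L - 0) k) with ((L - 0) * k) in HI2. unfold g. lra. }
        apply RInt_le_cont; [lra|intros; cont|intros; cont|].
        intros x _. set (p := pospart (- m t x)).
        assert (Hp : 0 <= p) by apply pospart_ge0.
        assert (- m t x <= p) by apply Rmax_l.
        assert (p <= k + / k ^ 2 * p ^ 3); [|lra].
        apply Rmult_le_reg_l with (k ^ 2); [assumption|].
        replace (k ^ 2 * (k + / k ^ 2 * p ^ 3)) with (k ^ 3 + p ^ 3) by (field; lra).
        destruct (Rle_dec p k).
        - assert (0 <= p ^ 3) by now apply pow_le. nra.
        - assert (0 <= k ^ 3) by (apply pow_le; lra).
          assert (0 <= p * ((p - k) * (p + k))) by (repeat apply Rmult_le_pos; lra). nra. }
      assert (/ k ^ 2 * g t <= / (4 * (eps + 1))).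
      { apply Rle_trans with (/ k ^ 2 * theta).
        - apply Rmult_le_compat_l; [now apply Rlt_le, Rinv_0_lt_compat|apply Rlt_le, Hgt].
        - right. unfold theta. field. lra. }
      assert ((eps + 1) * / (4 * (eps + 1)) = 1 / 4) by (field; lra).
      assert (0 < / (4 * (eps + 1))) by (apply Rinv_0_lt_compat; lra).
      assert (0 < k * L) by now apply Rmult_lt_0_compat.
      nra. }
    assert (HF : Rabs (F t) <= 2 + eps * KI).
    { eapply Rle_trans; [apply abs_price_le; assumption|].
      specialize (HI t ltac:(lra)). unfold revenue in HI. nra. }
    unfold g. rewrite <- RInt_scal_cont by (intros; cont).
    set (B := fun x => - 3 * pospart (- m t x) ^ 2 * (nu * mx t x + (F t - w t x) / 2 * m t x)).
    eapply Rle_trans.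
    { apply (RInt_le_flux _ (fun x => 3 / (2 * nu) * Q ^ 2 * pospart (- m t x) ^ 3) B
        (fun x => 6 * pospart (- m t x) * mx t x * (nu * mx t x + (F t - w t x) / 2 * m t x)
          - 3 * pospart (- m t x) ^ 2 * mt t x)); [lra|intros; cont|intros; cont|intros; unfold B; cont| |].
      - intros x Hx. unfold B. rewrite eqm by assumption. deriv. field.
      - intros x Hx. specialize (Hw t x ltac:(lra) ltac:(lra)).
        set (p := pospart (- m t x)). set (q := (F t - w t x) / 2).
        assert (Hp : 0 <= p) by apply pospart_ge0.
        assert (Hpm : p * m t x = - p ^ 2).
        { pose proof (mul_pospart (- m t x)) as E. fold p in E. nra. }
        assert (Hq : q ^ 2 <= Q ^ 2).
        { apply pow_maj_Rabs. unfold q, Q. apply Rabs_le.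
          apply Rabs_le_between in HF. apply Rabs_le_between in Hw. lra. }
        (* completing the square absorbs the drift into the diffusion *)
        assert (E : 6 * p * mx t x * (nu * mx t x + q * m t x) + 3 / (2 * nu) * q ^ 2 * p ^ 3
            = 6 * nu * p * (mx t x - q * p / (2 * nu)) ^ 2).
        { replace (6 * p * mx t x * (nu * mx t x + q * m t x))
            with (6 * nu * p * mx t x ^ 2 + 6 * mx t x * q * (p * m t x)) by ring.
          rewrite Hpm. field. lra. }
        assert (0 <= 6 * nu * p * (mx t x - q * p / (2 * nu)) ^ 2).
        { apply Rmult_le_pos; [nra|apply pow2_ge_0]. }
        assert (3 / (2 * nu) * q ^ 2 * p ^ 3 <= 3 / (2 * nu) * Q ^ 2 * p ^ 3).
        { apply Rmult_le_compat_r; [now apply pow_le|].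
          apply Rmult_le_compat_l; [apply Rlt_le, Rdiv_lt_0_compat; lra|exact Hq]. }
        lra. }
    assert (B L = 0 /\ B 0 = 0) as [-> ->].
    { unfold B. rewrite wr, ml. split.
      - replace (nu * mx t L + _) with 0; [ring|]. specialize (mr t ltac:(lra)). lra.
      - rewrite (pospart_eq0 (- 0)) by lra. ring. }
    lra.
  - apply Req_le, RInt_eq0; [lra|]. intros y Hy.
    rewrite mi by lra. rewrite pospart_eq0; [ring|]. specialize (m0_nonneg y ltac:(lra)). lra.
Qed.

Lemma m_nonneg t x : 0 <= m t x.
Proof.
  assert (S' := S). open_solution S'. rewrite km.
  apply m_nonneg_rect; apply clamp_in; lra.
Qed.

Lemma mass_nonneg t : 0 <= eta t.
Proof.
  assert (S' := S). open_solution S'.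
  apply RInt_nonneg_cont; [lra|intros; cont|intros; apply m_nonneg].
Qed.

(** Once the density is nonnegative this holds even at zero mass, because the
    revenue then vanishes too. *)
Lemma price_formula t : F t = (2 + eps * revenue t) / (2 + eps * eta t).
Proof.
  assert (S' := S). open_solution S'. assert (He := mass_nonneg t).
  assert (0 <= eps * eta t) by now apply Rmult_le_pos.
  unfold price, pbar, revenue.
  destruct (Req_dec (eta t) 0) as [E|E].
  - replace (RInt (fun x => w t x * m t x) 0 L) with 0.
    + rewrite E. unfold coef_c, coef_a. rewrite !Rmult_0_r. field.
    + symmetry. apply RInt_eq0; [lra|]. intros x Hx.
      rewrite (eq0_of_RInt_le0 (m t) 0 L hL); [ring|intros; cont|intros; apply m_nonneg| |exact Hx].
      now apply Req_le.
  - unfold coef_c, coef_a. field. repeat split; lra.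
Qed.

Lemma continuous_price t : continuous F t.
Proof.
  pose proof continuous_revenue as cI. pose proof continuous_mass as cM.
  assert (S' := S). open_solution S'.
  apply continuous_ext with (fun t => (2 + eps * revenue t) / (2 + eps * eta t)).
  - intros s. now rewrite price_formula.
  - assert (He := mass_nonneg t). assert (0 <= eps * eta t) by now apply Rmult_le_pos.
    cont.
Qed.

Lemma mx_left_nonneg t : 0 <= mx t 0.
Proof.
  assert (S' := S). open_solution S'.
  apply (derive_left_nonneg (m t) (mx t) L hL); [intros; cont|intros; cont|intros; now apply dmx| |apply ml].
  intros; apply m_nonneg.
Qed.

Lemma mass_le_1 t : 0 <= t <= T -> eta t <= 1.
Proof.
  intros Ht. assert (S' := S). open_solution S'.
  assert (H0 : eta 0 = 1).
  { rewrite <- m0_mass. apply RInt_ext. rewrite Rmin_left, Rmax_right by lra.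
    intros x Hx. apply mi; lra. }
  assert (- eta 0 <= - eta t); [|lra].
  apply (nondecreasing_of_derive (fun t => - eta t) (fun t => - RInt (mt t) 0 L)); [lra| | |].
  - intros s. pose proof continuous_mass as cM. cont.
  - intros s Hs. apply is_derive_Ropp.
    apply (is_derive_RInt_param_cont m mt 0 L 0 T); [lra|assumption..].
  - intros s Hs.
    assert (E : RInt (mt s) 0 L = (nu * mx s L + (F s - w s L) / 2 * m s L)
        - (nu * mx s 0 + (F s - w s 0) / 2 * m s 0) + RInt (fun _ => 0) 0 L).
    { apply (RInt_eq_flux _ _ (fun x => nu * mx s x + (F s - w s x) / 2 * m s x) (mt s));
        [lra|intros; cont|intros; cont|intros; cont| |intros; ring].
      intros x Hx. rewrite eqm by lra. deriv. field. }
    rewrite E, wr, ml, RInt_const. change (scal (L - 0) 0) with ((L - 0) * 0).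
    specialize (mr s ltac:(lra)). pose proof (mx_left_nonneg s). nra.
Qed.

(** * Positivity and monotonicity of the value function *)

(** The Hamiltonian is nonnegative, so [u] is a supersolution of a linear
    equation with zero boundary value at 0 and zero flux at [L]. *)
Lemma u_nonneg_rect t x : 0 <= t <= T -> 0 <= x <= L -> 0 <= u t x.
Proof.
  intros Ht Hx. assert (S' := S). open_solution S'.
  set (g := fun t => RInt (fun x => pospart (- u t x) ^ 3) 0 L).
  assert (Hg : g t <= 0).
  2:{ assert (- u t x <= 0); [|lra].
      apply (nonpos_of_RInt_pospart3 (fun x => - u t x) 0 L); try assumption. intros; cont. }
  apply (gronwall_backward g (fun t => RInt (fun x => - 3 * pospart (- u t x) ^ 2 * ut t x) 0 L)
    (- 3 * r) T); try assumption.
  - intros s. apply continuous_RInt_param; [lra|]. intros; cont.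
  - intros s Hs. apply (is_derive_RInt_param_cont (fun t x => pospart (- u t x) ^ 3)
      (fun t x => - 3 * pospart (- u t x) ^ 2 * ut t x) 0 L 0 T s Hs).
    + cont2_tac.
    + cont2_tac.
    + intros s' Hs' y. cbn beta. deriv; ring.
  - clear t Ht x Hx. intros t Ht. unfold g. rewrite <- RInt_scal_cont by (intros; cont).
    set (B := fun x => - (3 * nu * pospart (- u t x) ^ 2 * w t x)).
    eapply Rle_trans.
    { apply (RInt_le_flux _ (fun x => - 3 * pospart (- u t x) ^ 2 * ut t x) B
        (fun x => 6 * nu * pospart (- u t x) * w t x ^ 2 - 3 * nu * pospart (- u t x) ^ 2 * wx t x));
        [lra|intros; cont|intros; cont|intros; unfold B; cont| |].
      - intros x Hx. unfold B. deriv. ring.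
      - intros x Hx. rewrite equ by assumption.
        set (p := pospart (- u t x)).
        assert (Hp : 0 <= p) by apply pospart_ge0.
        assert (Hpm : p * u t x = - p ^ 2).
        { pose proof (mul_pospart (- u t x)) as E. fold p in E. nra. }
        assert (0 <= 6 * nu * p * w t x ^ 2) by (apply Rmult_le_pos; [nra|apply pow2_ge_0]).
        assert (0 <= 3 * p ^ 2 * ((F t - w t x) ^ 2 / 4)).
        { apply Rmult_le_pos; [nra|]. pose proof (pow2_ge_0 (F t - w t x)); lra. }
        assert (- 3 * p ^ 2 * (r * u t x) = 3 * r * p ^ 3).
        { transitivity (- 3 * r * p * (p * u t x)); [ring|rewrite Hpm; ring]. }
        lra. }
    unfold B. rewrite wr, ul, (pospart_eq0 (- 0)) by lra. lra.
  - apply Req_le, RInt_eq0; [lra|]. intros y Hy.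
    rewrite uf by lra. rewrite pospart_eq0; [ring|]. specialize (uT_nonneg y ltac:(lra)). lra.
Qed.

Lemma u_nonneg t x : 0 <= u t x.
Proof.
  assert (S' := S). open_solution S'. rewrite ku.
  apply u_nonneg_rect; apply clamp_in; lra.
Qed.

Lemma w_final x : 0 < x < L -> w T x = uT1 x.
Proof.
  intros Hx. assert (S' := S). open_solution S'.
  apply (derivatives_agree (u T) uT 0 L x); [exact Hx| |now apply dux|now apply uT_derive].
  intros y Hy. apply uf; lra.
Qed.

Lemma ut_left t : 0 < t < T -> ut t 0 = 0.
Proof.
  intros Ht. assert (S' := S). open_solution S'.
  rewrite <- (is_derive_unique _ _ _ (dut t Ht 0)).
  rewrite (Derive_ext _ (fun _ => 0)) by assumption. apply Derive_const.
Qed.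

(** The slope [w] need not have a time derivative, but its pairing with a
    function of [x] does: integrating by parts moves the space derivative from [u]
    to [psi], and [u] is differentiable in time. *)
Lemma is_derive_pairing psi psi' t :
  0 < t < T -> (forall x, continuous psi x) -> (forall x, continuous psi' x) ->
  (forall x, 0 < x < L -> is_derive psi x (psi' x)) ->
  is_derive (fun s => RInt (fun x => w s x * psi x) 0 L) t
    (ut t L * psi L - ut t 0 * psi 0 - RInt (fun x => ut t x * psi' x) 0 L).
Proof.
  intros Ht Hc Hc' Hd. assert (S' := S). open_solution S'.
  apply is_derive_ext with (fun s => u s L * psi L - u s 0 * psi 0 - RInt (fun x => u s x * psi' x) 0 L).
  - intros s. symmetry.
    rewrite (RInt_eq_flux _ (fun x => -1 * (u s x * psi' x)) (fun x => u s x * psi x)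
      (fun x => w s x * psi x + u s x * psi' x)); [|lra|intros; cont|intros; cont|intros; cont| |].
    + rewrite RInt_scal_cont by (intros; cont). ring_R.
    + intros x Hx. assert (H := Hd x Hx). assert (H' := dux s x Hx). deriv. ring.
    + intros; ring.
  - assert (H1 := dut t Ht L). assert (H2 := dut t Ht 0).
    assert (H3 : is_derive (fun s => RInt (fun x => u s x * psi' x) 0 L) t
                 (RInt (fun x => ut t x * psi' x) 0 L)).
    { apply (is_derive_RInt_param_cont (fun s x => u s x * psi' x) (fun s x => ut s x * psi' x) 0 L 0 T);
        [assumption|cont2_tac|cont2_tac|].
      intros s Hs x. cbn beta. deriv. ring. }
    apply is_derive_Rminus; [apply is_derive_Rminus|exact H3]; deriv; ring.
Qed.

(** Formally [w] solves the linear equation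
    [w_t = - nu w_xx + r w + q w_x] with [q = (F - w) / 2], vanishes at [L] and is
    nonnegative at the final time, while at 0 the equation for [u] reads
    [nu w_x = - (F - w) ^ 2 / 4], the sign that the boundary term of
    [RInt (pospart (- w) ^ 3)] requires.  The computation is carried out
    with the pairings of [w], so no time derivative of [w] is involved. *)
Lemma w_nonneg_rect t x : 0 <= t <= T -> 0 <= x <= L -> 0 <= w t x.
Proof.
  intros Ht Hx.
  pose proof continuous_price as cF.
  assert (S' := S). open_solution S'.
  destruct (bounded_on_interval _ T cF) as [KF [HKF HF]].
  destruct (bounded_on_rectangle w T L cw) as [Kw [HKw Hw]].
  set (Q := (KF + Kw) / 2). set (K := 3 / (8 * nu) * Q ^ 2 - 3 * r).
  set (g := fun t => RInt (fun x => pospart (- w t x) ^ 3) 0 L).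
  assert (Hg : g t <= 0).
  2:{ assert (- w t x <= 0); [|lra].
      apply (nonpos_of_RInt_pospart3 (fun x => - w t x) 0 L); try assumption. intros; cont. }
  set (psi := fun s x => - 3 * pospart (- w s x) ^ 2).
  set (psi' := fun s x => 6 * pospart (- w s x) * wx s x).
  assert (cpsi : cont2 psi) by (unfold psi; cont2_tac).
  assert (cpsi' : cont2 psi') by (unfold psi'; cont2_tac).
  set (P1 := fun tau s => ut tau L * psi s L - ut tau 0 * psi s 0
       - RInt (fun x => ut tau x * psi' s x) 0 L).
  apply (gronwall_backward g (fun t => P1 t t) K T); try assumption.
  - intros s. apply continuous_RInt_param; [lra|]. intros; cont.
  - intros s Hs.
    apply (is_derive_of_partial_squeeze g (fun tau s => RInt (fun x => w tau x * psi s x) 0 L) P1 0 T s Hs).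
    + intros a b. unfold P1. apply continuous_Rminus; [cont|].
      apply continuous_RInt_param; [lra|]. intros; cont.
    + intros a tau Htau. apply (is_derive_pairing (psi a) (psi' a) tau Htau); [intros; cont|intros; cont|].
      intros y Hy. unfold psi, psi'. deriv. ring.
    + intros a b _ _.
      assert (Hdiff : forall h1 h2 : R -> R, (forall x, continuous h1 x) -> (forall x, continuous h2 x) ->
         RInt h1 0 L - RInt h2 0 L = RInt (fun x => h1 x + -1 * h2 x) 0 L).
      { intros h1 h2 C1 C2. rewrite RInt_plus_cont, RInt_scal_cont; try assumption; [ring|intros; cont]. }
      unfold g. rewrite !Hdiff by (intros; cont).
      split; (apply RInt_le_cont; [lra|intros; cont|intros; cont|intros y _]).
      * pose proof (pospart3_convex (- w a y) (- w b y)). unfold psi. lra.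
      * pose proof (pospart3_convex (- w b y) (- w a y)). unfold psi. lra.
  - clear t Ht x Hx. intros t Ht. unfold g.
    specialize (HF t ltac:(lra)).
    set (B := fun x => (r * u t x - (F t - w t x) ^ 2 / 4) * psi t x).
    assert (H : RInt (fun x => - K * pospart (- w t x) ^ 3) 0 L
       <= B L - B 0 + RInt (fun x => - 1 * (ut t x * psi' t x)) 0 L).
    { apply (RInt_le_flux _ _ B (fun x => (r * w t x + (F t - w t x) / 2 * wx t x) * psi t x
          + (r * u t x - (F t - w t x) ^ 2 / 4) * psi' t x));
        [lra|intros; cont|intros; cont|intros; unfold B; cont| |].
      - intros x Hx. unfold B, psi, psi'. deriv. field.
      - intros x Hx. rewrite equ by assumption. specialize (Hw t x ltac:(lra) ltac:(lra)).
        unfold psi, psi'.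
        set (p := pospart (- w t x)). set (q := (F t - w t x) / 2).
        assert (Hp : 0 <= p) by apply pospart_ge0.
        assert (Hpm : p * w t x = - p ^ 2).
        { pose proof (mul_pospart (- w t x)) as E. fold p in E. nra. }
        assert (Hq : q ^ 2 <= Q ^ 2).
        { apply pow_maj_Rabs. unfold q, Q. apply Rabs_le.
          apply Rabs_le_between in HF. apply Rabs_le_between in Hw. lra. }
        assert (E : 6 * nu * p * wx t x ^ 2 - 3 * q * p ^ 2 * wx t x + 3 / (8 * nu) * q ^ 2 * p ^ 3
            = 6 * nu * p * (wx t x - q * p / (4 * nu)) ^ 2) by (field; lra).
        assert (0 <= 6 * nu * p * (wx t x - q * p / (4 * nu)) ^ 2).
        { apply Rmult_le_pos; [nra|apply pow2_ge_0]. }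
        assert (3 / (8 * nu) * q ^ 2 * p ^ 3 <= 3 / (8 * nu) * Q ^ 2 * p ^ 3).
        { apply Rmult_le_compat_r; [now apply pow_le|].
          apply Rmult_le_compat_l; [apply Rlt_le, Rdiv_lt_0_compat; lra|exact Hq]. }
        assert (r * w t x * (- 3 * p ^ 2) = 3 * r * p ^ 3).
        { transitivity (- 3 * r * p * (p * w t x)); [ring|rewrite Hpm; ring]. }
        unfold K. lra. }
    rewrite !RInt_scal_cont in H by (intros; cont).
    unfold P1. rewrite ut_left by assumption.
    assert (HL0 : psi t L = 0) by (unfold psi; rewrite wr, (pospart_eq0 (- 0)) by lra; ring).
    assert (HB0 : 0 <= B 0).
    { unfold B, psi. rewrite ul. pose proof (pow2_ge_0 (F t - w t 0)).
      pose proof (pow2_ge_0 (pospart (- w t 0))). nra. }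
    unfold B in H at 1. rewrite HL0 in *. lra.
  - apply Req_le, RInt_eq0; [lra|]. intros y Hy.
    rewrite w_final by lra. rewrite pospart_eq0; [ring|]. specialize (uT1_nonneg y ltac:(lra)). lra.
Qed.

Lemma w_nonneg t x : 0 <= w t x.
Proof.
  assert (S' := S). open_solution S'. rewrite kw.
  apply w_nonneg_rect; apply clamp_in; lra.
Qed.

Context {U0 D D0 D1 : R}.
Context (uT_le : forall x, 0 <= x <= L -> uT x <= U0).
Context (uT1_le : forall x, 0 < x < L -> uT1 x <= D).
Context (m0_le : forall x, 0 <= x <= L -> m0 x <= D0).
Context {m01 : R -> R}.
Context (m0_derive : forall x, 0 < x < L -> is_derive m0 x (m01 x)).
Context (m01_le : forall x, 0 < x < L -> Rabs (m01 x) <= D1).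

(** * The energy estimate *)

Definition energy t := RInt (fun x => w t x ^ 2 * m t x) 0 L.

Lemma continuous_energy t : continuous energy t.
Proof.
  assert (S' := S). open_solution S'. apply continuous_RInt_param; [lra|]. intros p x; cont.
Qed.

Lemma revenue_nonneg t : 0 <= revenue t.
Proof.
  assert (S' := S). open_solution S'.
  apply RInt_nonneg_cont; [lra|intros; cont|].
  intros x _. apply Rmult_le_pos; [apply w_nonneg|apply m_nonneg].
Qed.

Lemma energy_nonneg t : 0 <= energy t.
Proof.
  assert (S' := S). open_solution S'.
  apply RInt_nonneg_cont; [lra|intros; cont|].
  intros x _. apply Rmult_le_pos; [apply pow2_ge_0|apply m_nonneg].
Qed.

(** This is the Cauchy-Schwarz inequality [revenue ^ 2 <= eta * energy] in a form
    free of divisions, which stays meaningful when the mass vanishes. *)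
Lemma moments_quadratic_nonneg t a b :
  0 <= a ^ 2 * energy t - 2 * a * b * revenue t + b ^ 2 * eta t.
Proof.
  assert (S' := S). open_solution S'.
  replace (_ + _) with (RInt (fun x => (a * w t x - b) ^ 2 * m t x) 0 L).
  - apply RInt_nonneg_cont; [lra|intros; cont|].
    intros x _. apply Rmult_le_pos; [apply pow2_ge_0|apply m_nonneg].
  - rewrite (RInt_ext _ (fun x => a ^ 2 * (w t x ^ 2 * m t x)
       + (- 2 * a * b * (w t x * m t x) + b ^ 2 * m t x))) by (intros; ring_R).
    rewrite !RInt_plus_cont, !RInt_scal_cont by (intros; cont).
    unfold energy, revenue, mass. ring_R.
Qed.

(** The price is a convex combination of 1 and of the mean [revenue / eta], the
    weight of the mean being [eps * eta / (2 + eps * eta)].  Since [eta <= 1] this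
    weight is at most [eps / (2 + eps) < 1], which leaves a definite part of the
    energy uncompensated in [energy - F ^ 2 * eta]. *)
Lemma price_sq_mass_le t : 0 <= t <= T ->
  (2 + eps) * (F t ^ 2 * eta t) <= 2 + eps * energy t.
Proof.
  intros Ht. assert (S' := S). open_solution S'.
  assert (He := mass_nonneg t). assert (He1 := mass_le_1 t Ht).
  assert (HX := energy_nonneg t).
  assert (Q1 := moments_quadratic_nonneg t (eta t) (revenue t)).
  assert (Q2 := moments_quadratic_nonneg t 1 1).
  rewrite price_formula. set (e := eta t) in *. set (I := revenue t) in *. set (X := energy t) in *.
  assert (0 <= eps * e) by now apply Rmult_le_pos.
  assert (H1 : 0 <= eps ^ 2 * (e ^ 2 * X - 2 * e * I * I + I ^ 2 * e)).
  { apply Rmult_le_pos; [apply pow2_ge_0|exact Q1]. }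
  assert (H2 : 0 <= 2 * eps * e * (1 ^ 2 * X - 2 * 1 * 1 * I + 1 ^ 2 * e)).
  { apply Rmult_le_pos; [nra|exact Q2]. }
  assert (H3 : (2 + eps * I) ^ 2 * e <= (2 + eps * e) * (e * (2 + eps * X))) by nra.
  assert (H4 : ((2 + eps * I) / (2 + eps * e)) ^ 2 * e * (2 + eps * e) <= e * (2 + eps * X)).
  { apply Rmult_le_reg_r with (2 + eps * e); [lra|].
    replace (_ * _ * _ * _) with ((2 + eps * I) ^ 2 * e) by (field; lra). lra. }
  set (q := ((2 + eps * I) / (2 + eps * e)) ^ 2 * e) in *.
  assert (Hq : 0 <= q) by (apply Rmult_le_pos; [apply pow2_ge_0|assumption]).
  assert (0 <= eps * X) by now apply Rmult_le_pos.
  apply Rmult_le_reg_l with (2 + eps * e); [lra|].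
  apply Rle_trans with ((2 + eps) * (e * (2 + eps * X))); [nra|].
  rewrite <- Rmult_assoc. apply Rmult_le_compat_r; [lra|]. nra.
Qed.

Lemma revenue_sq_le t : 0 <= t <= T -> revenue t ^ 2 <= energy t.
Proof.
  intros Ht. assert (He1 := mass_le_1 t Ht).
  assert (Q := moments_quadratic_nonneg t 1 (revenue t)).
  pose proof (pow2_ge_0 (revenue t)). nra.
Qed.

Lemma price_sq_le t : 0 <= t <= T -> F t ^ 2 <= 2 + eps ^ 2 / 2 * energy t.
Proof.
  intros Ht. assert (S' := S). open_solution S'.
  assert (HI := revenue_sq_le t Ht). assert (HI0 := revenue_nonneg t).
  assert (He := mass_nonneg t). assert (0 <= eps * eta t) by now apply Rmult_le_pos.
  assert (0 <= eps * revenue t) by now apply Rmult_le_pos.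
  assert (0 <= F t <= (2 + eps * revenue t) / 2).
  { rewrite price_formula. split.
    - apply Rmult_le_pos; [lra|apply Rlt_le, Rinv_0_lt_compat; lra].
    - apply Rmult_le_compat_l; [lra|]. apply Rinv_le_contravar; lra. }
  assert (F t ^ 2 <= ((2 + eps * revenue t) / 2) ^ 2) by (apply pow_incr; lra).
  assert (eps ^ 2 * revenue t ^ 2 <= eps ^ 2 * energy t).
  { apply Rmult_le_compat_l; [apply pow2_ge_0|exact HI]. }
  pose proof (pow2_ge_0 (2 - eps * revenue t)). nra.
Qed.

(** Bounds the factors [exp (r * t)] and [exp (- r * t)] for [t] in [[0, T]],
    whatever the sign of [r]. *)
Definition growth := exp (Rabs r * T).

Lemma growth_pos : 0 < growth.
Proof. apply exp_pos. Qed.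

Lemma discount_bounds t : 0 <= t <= T ->
  / growth <= exp (- r * t) <= growth /\ exp (r * t) <= growth.
Proof.
  intros Ht. unfold growth. rewrite <- exp_Ropp.
  assert (mono : forall a b, a <= b -> exp a <= exp b).
  { intros a b [H| ->]; [now apply Rlt_le, exp_increasing|apply Rle_refl]. }
  pose proof (Rle_abs r). pose proof (Rle_abs (- r)). rewrite Rabs_Ropp in *.
  pose proof (Rabs_pos r).
  repeat split; apply mono; nra.
Qed.

Lemma U0_nonneg : 0 <= U0.
Proof.
  assert (S' := S). open_solution S'.
  apply Rle_trans with (uT L); [apply uT_nonneg|apply uT_le]; lra.
Qed.

Definition energy_bound := growth * (growth * T + 2 * (2 + eps) * (growth * U0)).

(** Duality between the two equations: the derivative of [exp (- r t) RInt (u m)]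
    is [exp (- r t) (energy - F ^ 2 * eta) / 4], where [price_sq_mass_le] bounds the
    negative term.  The end values are controlled by [uT] and by [u >= 0]. *)
Lemma energy_integral_le : RInt energy 0 T <= energy_bound.
Proof.
  pose proof continuous_energy as cX. pose proof continuous_price as cF.
  assert (S' := S). open_solution S'. assert (HM := growth_pos).
  set (Y := fun t => RInt (fun x => exp (- r * t) * (u t x * m t x)) 0 L).
  set (Y' := fun t => RInt (fun x => exp (- r * t)
     * (ut t x * m t x + u t x * mt t x - r * (u t x * m t x))) 0 L).
  assert (H : RInt (fun t => / (2 * (2 + eps)) * (/ growth * energy t + - growth)) 0 T <= Y T - Y 0).
  { apply (RInt_le_increment _ Y Y'); [lra|intros; cont| | |].
    - intros t. apply continuous_RInt_param; [lra|]. intros; cont.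
    - intros t Ht. apply (is_derive_RInt_param_cont (fun t x => exp (- r * t) * (u t x * m t x))
        (fun t x => exp (- r * t) * (ut t x * m t x + u t x * mt t x - r * (u t x * m t x))) 0 L 0 T);
        [lra|cont2_tac|cont2_tac|].
      intros s Hs x. cbn beta. deriv. ring.
    - intros t Ht.
      assert (E : Y' t = exp (- r * t) * ((energy t - F t ^ 2 * eta t) / 4)).
      { unfold Y'. rewrite RInt_scal_cont by (intros; cont). f_equal.
        rewrite (RInt_eq_flux _ (fun x => 1 / 4 * (w t x ^ 2 * m t x) + - F t ^ 2 / 4 * m t x)
          (fun x => u t x * (nu * mx t x + (F t - w t x) / 2 * m t x) - nu * w t x * m t x)
          (fun x => u t x * mt t x + w t x * ((F t - w t x) / 2 * m t x) - nu * wx t x * m t x));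
          [|lra|intros; cont|intros; cont|intros; cont| |].
        - rewrite RInt_plus_cont, !RInt_scal_cont by (intros; cont).
          rewrite wr, ul, ml. specialize (mr t ltac:(lra)).
          replace (nu * mx t L + (F t - 0) / 2 * m t L) with 0 by lra.
          unfold energy, mass. apply Rminus_diag_uniq. field.
        - intros x Hx. rewrite eqm by lra. deriv. field.
        - intros x Hx. rewrite equ by lra. field. }
      rewrite E.
      destruct (discount_bounds t ltac:(lra)) as [[Hl Hu] _].
      assert (HX := energy_nonneg t). assert (HF := price_sq_mass_le t ltac:(lra)).
      apply Rmult_le_reg_l with (2 * (2 + eps)); [lra|].
      rewrite <- Rmult_assoc, Rinv_r, Rmult_1_l by lra.
      apply Rle_trans with (exp (- r * t) * (energy t - 1)).
      + assert (/ growth * energy t <= exp (- r * t) * energy t) by now apply Rmult_le_compat_r. lra.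
      + rewrite (Rmult_comm (2 * (2 + eps))), Rmult_assoc. apply Rmult_le_compat_l; [apply Rlt_le, exp_pos|].
        nra. }
  rewrite RInt_scal_cont, RInt_plus_cont, RInt_scal_cont, RInt_const_R in H by (intros; cont).
  assert (HY0 : 0 <= Y 0).
  { apply RInt_nonneg_cont; [lra|intros; cont|]. intros x _.
    apply Rmult_le_pos; [apply Rlt_le, exp_pos|apply Rmult_le_pos; [apply u_nonneg|apply m_nonneg]]. }
  assert (HYT : Y T <= growth * U0).
  { apply Rle_trans with (RInt (fun x => growth * U0 * m T x) 0 L).
    - apply RInt_le_cont; [lra|intros; cont|intros; cont|]. intros x Hx.
      destruct (discount_bounds T ltac:(lra)) as [[Hl Hu] _].
      rewrite uf by lra. rewrite <- Rmult_assoc. apply Rmult_le_compat_r; [apply m_nonneg|].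
      apply Rmult_le_compat; [apply Rlt_le, exp_pos|apply uT_nonneg; lra|exact Hu|apply uT_le; lra].
    - rewrite RInt_scal_cont by (intros; cont). fold (mass L m T).
      assert (H1 := mass_le_1 T ltac:(lra)). assert (HU := U0_nonneg).
      assert (0 <= growth * U0) by (apply Rmult_le_pos; lra). nra. }
  unfold energy_bound. set (X := RInt energy 0 T) in *.
  assert (H2 : / growth * X <= growth * T + 2 * (2 + eps) * (growth * U0)).
  { apply Rmult_le_compat_l with (r := 2 * (2 + eps)) in H; [|lra].
    rewrite <- Rmult_assoc, Rinv_r, Rmult_1_l in H by lra. nra. }
  apply Rmult_le_compat_l with (r := growth) in H2; [|lra].
  rewrite <- Rmult_assoc, Rinv_r, Rmult_1_l in H2 by lra. exact H2.
Qed.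

(** * Bound of the value function and interior integrability of its slope *)

Definition price_sq_bound := 2 * T + eps ^ 2 / 2 * energy_bound.

Lemma price_sq_integral_le : RInt (fun t => F t ^ 2) 0 T <= price_sq_bound.
Proof.
  pose proof continuous_energy as cX. pose proof continuous_price as cF.
  assert (S' := S). open_solution S'.
  apply Rle_trans with (RInt (fun t => 2 + eps ^ 2 / 2 * energy t) 0 T).
  - apply RInt_le_cont; [lra|intros; cont|intros; cont|]. intros t Ht. apply price_sq_le; lra.
  - rewrite RInt_plus_cont, RInt_scal_cont, RInt_const_R by (intros; cont).
    unfold price_sq_bound. pose proof energy_integral_le.
    assert (0 <= eps ^ 2 / 2) by (pose proof (pow2_ge_0 eps); lra). nra.
Qed.

Definition u_bound := growth * (growth * U0 + growth / 4 * price_sq_bound).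

(** The function [exp (r t) * b t], constant in [x], with
    [b' = - exp (- r t) F ^ 2 / 4], is a supersolution: at a maximum of the
    difference the slope [w] vanishes and the Hamiltonian is [F ^ 2 / 4].  Its
    bound comes from that of the time integral of [F ^ 2]. *)
Lemma u_le_bound t x : 0 <= t <= T -> 0 <= x <= L -> u t x <= u_bound.
Proof.
  intros Ht Hx.
  pose proof continuous_price as cF.
  assert (S' := S). open_solution S'. assert (HM := growth_pos).
  destruct (bounded_on_interval _ T cF) as [KF [HKF HF]].
  destruct (bounded_on_rectangle w T L cw) as [Kw [HKw Hw]].
  set (Q := (2 * KF + Kw) / 4). set (K := 3 / (8 * nu) * Q ^ 2).
  set (f := fun t => exp (- r * t) * F t ^ 2 / 4).
  assert (cf : forall t, continuous f t) by (intros; unfold f; cont).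
  set (c := growth * U0 + RInt f 0 T).
  set (b := fun t => c - RInt f 0 t).
  assert (cb : forall t, continuous b t).
  { intros s. unfold b. cont. now apply continuous_RInt_upper. }
  assert (fpos : forall t, 0 <= f t).
  { intros s. unfold f. apply Rmult_le_pos; [|lra].
    apply Rmult_le_pos; [apply Rlt_le, exp_pos|apply pow2_ge_0]. }
  set (V := fun t x => exp (- r * t) * u t x - b t).
  assert (cV : cont2 V) by (unfold V; cont2_tac).
  set (g := fun t => RInt (fun x => pospart (V t x) ^ 3) 0 L).
  set (g' := fun t => RInt (fun x => 3 * pospart (V t x) ^ 2 *
      (exp (- r * t) * (ut t x - r * u t x) + f t)) 0 L).
  assert (HU := U0_nonneg).
  assert (Hb0 : forall t, 0 <= t <= T -> 0 <= b t).
  { intros s Hs. unfold b, c.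
    assert (RInt f 0 s <= RInt f 0 T).
    { apply RInt_subinterval_le; try lra; [assumption|intros; apply fpos]. }
    assert (0 <= growth * U0) by (apply Rmult_le_pos; lra). lra. }
  assert (Hg : g t <= 0).
  2:{ assert (HV : V t x <= 0).
      { apply (nonpos_of_RInt_pospart3 (V t) 0 L); try assumption. intros; cont. }
      unfold V in HV.
      assert (Hbc : b t <= growth * U0 + growth / 4 * price_sq_bound).
      { unfold b, c.
        assert (0 <= RInt f 0 t) by (apply RInt_nonneg_cont; [lra|assumption|intros; apply fpos]).
        assert (RInt f 0 T <= growth / 4 * price_sq_bound); [|lra].
        apply Rle_trans with (RInt (fun t => growth / 4 * F t ^ 2) 0 T).
        - apply RInt_le_cont; [lra|assumption|intros; cont|]. intros s Hs. unfold f.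
          destruct (discount_bounds s ltac:(lra)) as [[_ Hge] _].
          assert (exp (- r * s) * F s ^ 2 <= growth * F s ^ 2)
            by (apply Rmult_le_compat_r; [apply pow2_ge_0|exact Hge]). lra.
        - rewrite RInt_scal_cont by (intros; cont). apply Rmult_le_compat_l; [lra|].
          apply price_sq_integral_le. }
      assert (E : u t x = exp (r * t) * (exp (- r * t) * u t x)).
      { rewrite <- Rmult_assoc, <- exp_plus. replace (r * t + - r * t) with 0 by ring.
        rewrite exp_0; ring. }
      rewrite E. unfold u_bound. destruct (discount_bounds t Ht) as [_ H].
      apply Rmult_le_compat; [apply Rlt_le, exp_pos| |exact H|lra].
      apply Rmult_le_pos; [apply Rlt_le, exp_pos|apply u_nonneg]. }
  apply (gronwall_backward g g' K T); try assumption.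
  - intros s. apply continuous_RInt_param; [lra|]. intros; cont.
  - intros s Hs. apply (is_derive_RInt_param_cont (fun t x => pospart (V t x) ^ 3)
      (fun t x => 3 * pospart (V t x) ^ 2 *
      (exp (- r * t) * (ut t x - r * u t x) + f t)) 0 L 0 T s Hs).
    + cont2_tac.
    + cont2_tac.
    + intros s' Hs' y. cbn beta.
      assert (HbD : is_derive b s' (0 - f s')).
      { apply is_derive_Rminus; [apply is_derive_Rconst|now apply is_derive_RInt_upper]. }
      assert (HVD : is_derive (fun s => V s y) s' (exp (- r * s') * (ut s' y - r * u s' y) + f s')).
      { unfold V. deriv. ring. }
      deriv. ring.
  - clear t Ht x Hx. intros t Ht. specialize (HF t ltac:(lra)).
    set (B := fun x => 3 * nu * pospart (V t x) ^ 2 * (exp (- r * t) * w t x)).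
    assert (H : RInt (fun x => - K * pospart (V t x) ^ 3) 0 L <= B L - B 0 + g' t).
    { apply (RInt_le_flux _ _ B (fun x =>
          6 * nu * pospart (V t x) * (exp (- r * t) * w t x) ^ 2
          + 3 * nu * pospart (V t x) ^ 2 * (exp (- r * t) * wx t x)));
        [lra|intros; cont|intros; cont|intros; unfold B; cont| |].
      - intros x Hx.
        assert (HVD : is_derive (fun y => V t y) x (exp (- r * t) * w t x)) by (unfold V; deriv; ring).
        unfold B. deriv. ring.
      - intros x Hx. rewrite equ by assumption. specialize (Hw t x ltac:(lra) ltac:(lra)).
        unfold f. set (p := pospart (V t x)). set (e := exp (- r * t)). set (s := (2 * F t - w t x) / 4).
        assert (Hp : 0 <= p) by apply pospart_ge0.
        assert (Hq : s ^ 2 <= Q ^ 2).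
        { apply pow_maj_Rabs. unfold s, Q. apply Rabs_le.
          apply Rabs_le_between in HF. apply Rabs_le_between in Hw. lra. }
        assert (E : 6 * nu * p * (e * w t x) ^ 2 + 3 * p ^ 2 * (e * w t x) * s
             + 3 / (8 * nu) * s ^ 2 * p ^ 3
            = 6 * nu * p * (e * w t x + s * p / (4 * nu)) ^ 2) by (field; lra).
        assert (0 <= 6 * nu * p * (e * w t x + s * p / (4 * nu)) ^ 2).
        { apply Rmult_le_pos; [nra|apply pow2_ge_0]. }
        assert (3 / (8 * nu) * s ^ 2 * p ^ 3 <= 3 / (8 * nu) * Q ^ 2 * p ^ 3).
        { apply Rmult_le_compat_r; [now apply pow_le|].
          apply Rmult_le_compat_l; [apply Rlt_le, Rdiv_lt_0_compat; lra|exact Hq]. }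
        assert (E2 : 3 * p ^ 2 * (e * w t x) * s
           = 3 * p ^ 2 * (e * (- (F t - w t x) ^ 2 / 4) + e * F t ^ 2 / 4)) by (unfold s; field).
        unfold K. lra. }
    assert (HB : B L = 0 /\ B 0 = 0) .
    { unfold B. rewrite wr. split; [ring|].
      rewrite pospart_eq0; [ring|]. unfold V. rewrite ul. specialize (Hb0 t ltac:(lra)). lra. }
    destruct HB as [HB1 HB2]. rewrite HB1, HB2, RInt_scal_cont in H by (intros; cont).
    unfold g. lra.
  - apply Req_le, RInt_eq0; [lra|]. intros y Hy.
    rewrite pospart_eq0; [ring|]. unfold V, b, c. rewrite uf by lra.
    destruct (discount_bounds T ltac:(lra)) as [[_ H] _].
    assert (exp (- r * T) * uT y <= growth * U0).
    { apply Rmult_le_compat; [apply Rlt_le, exp_pos|apply uT_nonneg; lra|exact H|apply uT_le; lra]. }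
    lra.
Qed.

Lemma u_bound_nonneg : 0 <= u_bound.
Proof.
  assert (S' := S). open_solution S'.
  apply Rle_trans with (u 0 0); [apply u_nonneg|apply u_le_bound; lra].
Qed.

Definition hamiltonian_moment t := RInt (fun x => x * ((F t - w t x) ^ 2 / 4)) 0 L.

Lemma continuous_hamiltonian_moment t : continuous hamiltonian_moment t.
Proof.
  pose proof continuous_price as cF.
  assert (S' := S). open_solution S'. apply continuous_RInt_param; [lra|]. intros p x; cont.
Qed.

Definition hamiltonian_bound := L * (L * u_bound) + T * ((nu + Rabs r * (L * L)) * u_bound).

(** Testing the equation for [u] with [x] gives the Hamiltonian a good sign; the
    weight kills the unknown slope [w t 0], and every other term is bounded by
    [u_bound]. *)
Lemma hamiltonian_integral_le : RInt hamiltonian_moment 0 T <= hamiltonian_bound.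
Proof.
  pose proof continuous_price as cF. pose proof continuous_hamiltonian_moment as cH.
  assert (S' := S). open_solution S'. assert (HU := u_bound_nonneg).
  set (Z := fun t => RInt (fun x => x * u t x) 0 L).
  assert (cZ : forall t, continuous Z t).
  { intros t. apply continuous_RInt_param; [lra|]. intros; cont. }
  assert (HZ : forall t, 0 <= t <= T -> 0 <= Z t <= L * (L * u_bound)).
  { intros t Ht. split.
    - apply RInt_nonneg_cont; [lra|intros; cont|]. intros x Hx.
      apply Rmult_le_pos; [lra|apply u_nonneg].
    - apply Rle_trans with (RInt (fun _ => L * u_bound) 0 L).
      + apply RInt_le_cont; [lra|intros; cont|intros; cont|]. intros x Hx.
        apply Rmult_le_compat; [lra|apply u_nonneg|lra|apply u_le_bound; lra].
      + rewrite RInt_const_R. lra. }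
  assert (H : RInt (fun t => hamiltonian_moment t + - ((nu + Rabs r * (L * L)) * u_bound)) 0 T
      <= - Z T - - Z 0).
  { apply (RInt_le_increment _ (fun t => - Z t) (fun t => - RInt (fun x => x * ut t x) 0 L));
      [lra|intros; cont|intros; cont| |].
    - intros t Ht. apply is_derive_Ropp.
      apply (is_derive_RInt_param_cont (fun t x => x * u t x) (fun t x => x * ut t x) 0 L 0 T);
        [lra|cont2_tac|cont2_tac|].
      intros s Hs x. cbn beta. deriv. ring.
    - intros t Ht.
      rewrite (RInt_eq_flux _ (fun x => r * (x * u t x) + -1 * (x * ((F t - w t x) ^ 2 / 4)))
        (fun x => nu * u t x - nu * x * w t x) (fun x => - nu * x * wx t x));
        [|lra|intros; cont|intros; cont|intros; cont| |].
      + rewrite RInt_plus_cont, !RInt_scal_cont by (intros; cont).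
        fold (Z t). fold (hamiltonian_moment t). rewrite wr, ul.
        assert (u t L <= u_bound) by (apply u_le_bound; lra).
        destruct (HZ t ltac:(lra)) as [Z0 Z1].
        assert (r * Z t <= Rabs r * (L * (L * u_bound))).
        { apply Rle_trans with (Rabs r * Z t); [apply Rmult_le_compat_r; [exact Z0|apply Rle_abs]|].
          apply Rmult_le_compat_l; [apply Rabs_pos|exact Z1]. }
        nra.
      + intros x Hx. deriv. ring.
      + intros x Hx. rewrite equ by lra. field. }
  rewrite RInt_plus_cont, RInt_const_R in H by (intros; cont).
  destruct (HZ 0 ltac:(lra)). destruct (HZ T ltac:(lra)). unfold hamiltonian_bound. nra.
Qed.

(** * The entropy estimate *)

Definition fisher t := RInt (fun x => mx t x ^ 2 / (1 + m t x)) 0 L.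

Lemma continuous_fisher t : continuous fisher t.
Proof.
  assert (S' := S). open_solution S'. apply continuous_RInt_param; [lra|]. intros p x; cont.
  cbn. pose proof (m_nonneg p x); lra.
Qed.

(** The entropy of [1 + y] rather than of [y]: its derivative [ln (1 + y)]
    vanishes at 0, so the flux of the density through the boundary point 0 makes no
    contribution. *)
Definition entropy_density y := (1 + y) * ln (1 + y) - y.

Lemma entropy_density_nonneg y : 0 <= y -> 0 <= entropy_density y.
Proof.
  intros Hy. unfold entropy_density.
  assert (H := exp_ineq1_le (- ln (1 + y))). rewrite exp_Ropp, exp_ln in H by lra.
  apply Rmult_le_compat_l with (r := 1 + y) in H; [|lra].
  rewrite Rinv_r in H; lra.
Qed.

Definition fisher_bound :=
  2 / nu * (RInt (fun x => entropy_density (m0 x)) 0 L + (T + 2 * energy_bound) / (4 * nu)).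

(** The entropy dissipates [nu * fisher]; the drift produces at most
    [nu / 2 * fisher] plus the integral of [((F - w) / 2) ^ 2 * m], which the
    energy estimate controls. *)
Lemma fisher_integral_le : RInt fisher 0 T <= fisher_bound.
Proof.
  pose proof continuous_price as cF. pose proof continuous_energy as cX. pose proof continuous_fisher as cD.
  assert (S' := S). open_solution S'.
  assert (Hm : forall t x, 1 + m t x <> 0) by (intros t x; pose proof (m_nonneg t x); lra).
  assert (Hm' : forall t x, 0 < 1 + m t x) by (intros t x; pose proof (m_nonneg t x); lra).
  set (Y := fun t => RInt (fun x => entropy_density (m t x)) 0 L).
  assert (cY : forall t, continuous Y t).
  { intros t. apply continuous_RInt_param; [lra|]. intros; unfold entropy_density; cont. apply Hm'. }
  assert (H : RInt (fun t => nu / 2 * fisher t + - / (4 * nu) * (1 + 2 * energy t)) 0 T <= - Y T - - Y 0).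
  { apply (RInt_le_increment _ (fun t => - Y t) (fun t => - RInt (fun x => ln (1 + m t x) * mt t x) 0 L));
      [lra|intros; cont|intros; cont| |].
    - intros t Ht. apply is_derive_Ropp.
      apply (is_derive_RInt_param_cont (fun t x => entropy_density (m t x))
         (fun t x => ln (1 + m t x) * mt t x) 0 L 0 T);
        [lra|unfold entropy_density; cont2_tac; apply Hm'|cont2_tac; apply Hm'|].
      intros s Hs x. unfold entropy_density. deriv; [apply Hm'|field; apply Hm].
    - intros t Ht.
      set (B := fun x => ln (1 + m t x) * (nu * mx t x + (F t - w t x) / 2 * m t x)).
      assert (E : RInt (fun x => ln (1 + m t x) * mt t x) 0 L
         <= B L - B 0 + RInt (fun x => - (nu / 2) * (mx t x ^ 2 / (1 + m t x))
              + / (4 * nu) * (F t ^ 2 * m t x + w t x ^ 2 * m t x)) 0 L).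
      { apply (RInt_le_flux _ _ B (fun x => mx t x / (1 + m t x) * (nu * mx t x + (F t - w t x) / 2 * m t x)
            + ln (1 + m t x) * mt t x)); [lra| | | | |].
        - intros x. cont. apply Hm'.
        - intros x. cont. apply Hm.
        - intros x. unfold B. cont. apply Hm'.
        - intros x Hx. unfold B. rewrite eqm by lra. deriv; [apply Hm'|field; apply Hm].
        - intros x Hx. set (q := (F t - w t x) / 2). specialize (Hm' t x). set (y := m t x) in *.
          assert (Hy : 0 <= y) by apply m_nonneg.
          assert (Hq : q ^ 2 * y <= (F t ^ 2 * y + w t x ^ 2 * y) / 2).
          { assert (q ^ 2 <= (F t ^ 2 + w t x ^ 2) / 2)
              by (unfold q; pose proof (pow2_ge_0 (F t + w t x)); lra).
            apply Rmult_le_compat_r with (r := y) in H; lra. }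
          assert (E1 : mx t x / (1 + y) * (nu * mx t x + q * y)
             = nu / 2 * (mx t x ^ 2 / (1 + y))
               + nu / 2 / (1 + y) * (mx t x + q * y / nu) ^ 2 - q ^ 2 * y * (y / (1 + y)) / (2 * nu))
            by (field; lra).
          assert (0 <= nu / 2 / (1 + y) * (mx t x + q * y / nu) ^ 2).
          { apply Rmult_le_pos; [|apply pow2_ge_0]. apply Rlt_le; repeat apply Rdiv_lt_0_compat; lra. }
          assert (q ^ 2 * y * (y / (1 + y)) / (2 * nu) <= / (4 * nu) * (F t ^ 2 * y + w t x ^ 2 * y)).
          { apply Rle_trans with (q ^ 2 * y / (2 * nu)).
            - apply Rmult_le_compat_r; [apply Rlt_le, Rinv_0_lt_compat; lra|].
              rewrite <- (Rmult_1_r (q ^ 2 * y)) at 2. apply Rmult_le_compat_l.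
              + apply Rmult_le_pos; [apply pow2_ge_0|exact Hy].
              + apply Rmult_le_reg_r with (1 + y); [lra|]. unfold Rdiv.
                rewrite Rmult_assoc, Rinv_l; lra.
            - apply Rle_trans with ((F t ^ 2 * y + w t x ^ 2 * y) / 2 / (2 * nu)); [|right; field; lra].
              apply Rmult_le_compat_r; [apply Rlt_le, Rinv_0_lt_compat; lra|exact Hq]. }
          lra. }
      rewrite RInt_plus_cont, !RInt_scal_cont, RInt_plus_cont, RInt_scal_cont in E
        by (intros; cont; apply Hm).
      fold (fisher t) (energy t) (mass L m t) in E.
      assert (HB : B L = 0 /\ B 0 = 0).
      { unfold B. rewrite wr, ml, Rplus_0_r, ln_1. specialize (mr t ltac:(lra)).
        replace (nu * mx t L + (F t - 0) / 2 * m t L) with 0 by lra. split; ring. }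
      destruct HB as [HB1 HB2]. rewrite HB1, HB2 in E.
      assert (HP := price_sq_mass_le t ltac:(lra)).
      assert (HX := energy_nonneg t).
      assert (F t ^ 2 * eta t <= 1 + energy t) by nra.
      assert (/ (4 * nu) * (F t ^ 2 * eta t + energy t) <= / (4 * nu) * (1 + 2 * energy t)).
      { apply Rmult_le_compat_l; [apply Rlt_le, Rinv_0_lt_compat; lra|lra]. }
      lra. }
  rewrite RInt_plus_cont, !RInt_scal_cont, RInt_plus_cont, RInt_scal_cont, RInt_const_R in H
    by (intros; cont).
  assert (HYT : 0 <= Y T).
  { apply RInt_nonneg_cont; [lra|intros; unfold entropy_density; cont; apply Hm'|].
    intros x _. apply entropy_density_nonneg, m_nonneg. }
  assert (HY0 : Y 0 = RInt (fun x => entropy_density (m0 x)) 0 L).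
  { apply RInt_ext. rewrite Rmin_left, Rmax_right by lra. intros x Hx. now rewrite mi by lra. }
  assert (HE := energy_integral_le).
  unfold fisher_bound. rewrite <- HY0.
  apply Rmult_le_reg_l with (nu / 2); [lra|].
  rewrite <- Rmult_assoc. replace (nu / 2 * (2 / nu)) with 1 by (field; lra). rewrite Rmult_1_l.
  assert (/ (4 * nu) * ((T - 0) * 1 + 2 * RInt energy 0 T) <= (T + 2 * energy_bound) / (4 * nu)).
  { rewrite Rmult_comm. apply Rmult_le_compat_r; [apply Rlt_le, Rinv_0_lt_compat; lra|lra]. }
  lra.
Qed.

(** * Weighted revenues *)

(** The revenue with weight [a * x ^ 2 + b].  The weights [x ^ 2] and
    [L ^ 2 - x ^ 2] vanish at one end each and have a derivative of size [x], which
    is what the bound on [hamiltonian_moment] can absorb near 0. *)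
Definition moment (a b t : R) := RInt (fun x => w t x * (m t x * (a * x ^ 2 + b))) 0 L.

Definition remainder t := RInt (fun x => 4 * nu * x * w t x * mx t x + 2 * nu * w t x * m t x
   + x * (F t - w t x) * w t x * m t x) 0 L.

Definition remainder_majorant t :=
  (8 * nu * L ^ 2 + nu + L / 2) + (2 * nu * eps ^ 2 * L ^ 2 + 2 * nu * L + nu + 2 * L) * energy t
  + 16 * nu * hamiltonian_moment t + 2 * nu * L * fisher t.

(** The delicate term is [x w m_x].  By Young's inequality it is at most
    [x w ^ 2 (1 + m) + x m_x ^ 2 / (1 + m)]: the first part splits into
    [x w ^ 2], controlled by the Hamiltonian, and [x w ^ 2 m], controlled by the
    energy, and the last part is the integrand of [fisher]. *)
Lemma abs_remainder_le t : 0 <= t <= T -> Rabs (remainder t) <= remainder_majorant t.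
Proof.
  intros Ht. assert (S' := S). open_solution S'.
  assert (Hm : forall x, 1 + m t x <> 0) by (intros x; pose proof (m_nonneg t x); lra).
  set (N := fun x => 2 * nu * (2 * L * F t ^ 2) + 16 * nu * (x * ((F t - w t x) ^ 2 / 4))
     + ((2 * nu * L + nu + 3 / 2 * L) * (w t x ^ 2 * m t x)
     + (2 * nu * L * (mx t x ^ 2 / (1 + m t x)) + (nu + L / 2 * F t ^ 2) * m t x))).
  assert (cN : forall x, continuous N x) by (intros x; unfold N; cont; apply Hm).
  assert (HN : RInt N 0 L <= remainder_majorant t).
  { unfold N. rewrite RInt_plus_cont, RInt_plus_cont, RInt_const_R, RInt_plus_cont, RInt_plus_cont,
      !RInt_scal_cont by (intros; cont; apply Hm).
    fold (hamiltonian_moment t) (energy t) (fisher t) (mass L m t).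
    unfold remainder_majorant.
    assert (H1 := price_sq_le t Ht). assert (H2 := price_sq_mass_le t Ht).
    assert (HX := energy_nonneg t). assert (H3 := mass_le_1 t Ht).
    assert (H4 : F t ^ 2 * eta t <= 1 + energy t) by nra.
    assert (nu * L ^ 2 * F t ^ 2 <= nu * L ^ 2 * (2 + eps ^ 2 / 2 * energy t)).
    { apply Rmult_le_compat_l; [|exact H1]. apply Rmult_le_pos; [lra|apply pow2_ge_0]. }
    assert (L * (F t ^ 2 * eta t) <= L * (1 + energy t)) by (apply Rmult_le_compat_l; lra).
    assert (nu * eta t <= nu) by nra.
    lra. }
  apply Rle_trans with (RInt N 0 L); [|exact HN].
  assert (Hpt : forall x, 0 < x < L -> Rabs (4 * nu * x * w t x * mx t x + 2 * nu * w t x * m t x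
     + x * (F t - w t x) * w t x * m t x) <= N x).
  { intros x Hx. unfold N. specialize (Hm x).
    assert (Hy := m_nonneg t x). assert (Hw := w_nonneg t x).
    set (y := m t x) in *. set (v := w t x) in *. set (f := F t). set (z := mx t x).
    assert (A1 : Rabs (4 * nu * x * v * z) <= 2 * nu * (x * v ^ 2 * (1 + y) + L * (z ^ 2 / (1 + y)))).
    { apply Rle_trans with (2 * nu * (x * v ^ 2 * (1 + y) + x * (z ^ 2 / (1 + y)))).
      - assert (E1 : x * v ^ 2 * (1 + y) + x * (z ^ 2 / (1 + y)) - 2 * (x * v * z)
            = x / (1 + y) * (v * (1 + y) - z) ^ 2) by (field; lra).
        assert (E2 : x * v ^ 2 * (1 + y) + x * (z ^ 2 / (1 + y)) + 2 * (x * v * z)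
            = x / (1 + y) * (v * (1 + y) + z) ^ 2) by (field; lra).
        assert (0 < x / (1 + y)) by (apply Rdiv_lt_0_compat; lra).
        assert (0 <= x / (1 + y) * (v * (1 + y) - z) ^ 2) by (apply Rmult_le_pos; [lra|apply pow2_ge_0]).
        assert (0 <= x / (1 + y) * (v * (1 + y) + z) ^ 2) by (apply Rmult_le_pos; [lra|apply pow2_ge_0]).
        apply Rabs_le. split; nra.
      - apply Rmult_le_compat_l; [lra|]. apply Rplus_le_compat_l, Rmult_le_compat_r; [|lra].
        apply Rmult_le_pos; [apply pow2_ge_0|apply Rlt_le, Rinv_0_lt_compat; lra]. }
    assert (A2 : Rabs (2 * nu * v * y) <= nu * (v ^ 2 * y + y)).
    { rewrite Rabs_pos_eq by (repeat apply Rmult_le_pos; lra).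
      assert (0 <= nu * y * (v - 1) ^ 2) by (apply Rmult_le_pos; [nra|apply pow2_ge_0]). lra. }
    assert (A3 : Rabs (x * (f - v) * v * y) <= L * (f ^ 2 * y / 2 + 3 / 2 * (v ^ 2 * y))).
    { replace (x * (f - v) * v * y) with (x * ((f - v) * v * y)) by ring.
      rewrite Rabs_mult, (Rabs_pos_eq x) by lra.
      apply Rmult_le_compat; [lra|apply Rabs_pos|lra|].
      assert (0 <= y * (f + v) ^ 2) by (apply Rmult_le_pos; [lra|apply pow2_ge_0]).
      assert (0 <= y * (f - v) ^ 2) by (apply Rmult_le_pos; [lra|apply pow2_ge_0]).
      assert (0 <= y * v ^ 2) by (apply Rmult_le_pos; [lra|apply pow2_ge_0]).
      apply Rabs_le; split; lra. }
    (* [w = F - (F - w)], and the Hamiltonian is [(F - w) ^ 2 / 4] *)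
    assert (A4 : x * v ^ 2 <= 2 * L * f ^ 2 + 8 * (x * ((f - v) ^ 2 / 4))).
    { assert (0 <= x * (2 * f - v) ^ 2) by (apply Rmult_le_pos; [lra|apply pow2_ge_0]).
      assert (x * f ^ 2 <= L * f ^ 2) by (apply Rmult_le_compat_r; [apply pow2_ge_0|lra]).
      nra. }
    assert (A5 : x * v ^ 2 * y <= L * (v ^ 2 * y)).
    { rewrite Rmult_assoc. apply Rmult_le_compat_r; [|lra]. apply Rmult_le_pos; [apply pow2_ge_0|lra]. }
    eapply Rle_trans; [apply Rabs_triang|].
    eapply Rle_trans; [apply Rplus_le_compat_r, Rabs_triang|].
    assert (nu * (x * v ^ 2) <= nu * (2 * L * f ^ 2 + 8 * (x * ((f - v) ^ 2 / 4))))
      by (apply Rmult_le_compat_l; lra).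
    assert (nu * (x * v ^ 2 * y) <= nu * (L * (v ^ 2 * y))) by (apply Rmult_le_compat_l; lra).
    lra. }
  unfold remainder. apply Rabs_le. split.
  - assert (RInt (fun x => -1 * N x) 0 L <= remainder t).
    { apply RInt_le_cont; [lra|intros; cont|intros; cont|]. intros x Hx. specialize (Hpt x Hx).
      apply Rabs_le_between in Hpt. lra. }
    rewrite RInt_scal_cont in H by assumption. unfold remainder in H. lra.
  - apply RInt_le_cont; [lra|intros; cont|intros; cont|]. intros x Hx. specialize (Hpt x Hx).
    apply Rabs_le_between in Hpt. lra.
Qed.

Definition remainder_bound :=
  T * (8 * nu * L ^ 2 + nu + L / 2)
  + (2 * nu * eps ^ 2 * L ^ 2 + 2 * nu * L + nu + 2 * L) * energy_bound
  + 16 * nu * hamiltonian_bound + 2 * nu * L * fisher_bound.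

Lemma continuous_remainder_majorant t : continuous remainder_majorant t.
Proof.
  pose proof continuous_energy. pose proof continuous_fisher. pose proof continuous_hamiltonian_moment.
  unfold remainder_majorant. cont.
Qed.

Lemma remainder_majorant_integral_le : RInt remainder_majorant 0 T <= remainder_bound.
Proof.
  pose proof continuous_energy. pose proof continuous_fisher. pose proof continuous_hamiltonian_moment.
  assert (S' := S). open_solution S'.
  unfold remainder_majorant.
  rewrite RInt_plus_cont, RInt_plus_cont, RInt_plus_cont, !RInt_scal_cont, RInt_const_R by (intros; cont).
  pose proof energy_integral_le. pose proof hamiltonian_integral_le. pose proof fisher_integral_le.
  unfold remainder_bound. rewrite Rminus_0_r.
  assert (0 <= nu * eps ^ 2 * L ^ 2) by (repeat apply Rmult_le_pos; try apply pow2_ge_0; lra).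
  assert (0 < nu * L) by nra.
  repeat apply Rplus_le_compat; [apply Rle_refl| | |]; apply Rmult_le_compat_l; lra.
Qed.

Lemma wx_right_nonpos t : wx t L <= 0.
Proof.
  assert (S' := S). open_solution S'.
  apply (derive_right_nonpos (w t) (wx t) L hL); [intros; cont|intros; cont|intros; now apply dwx| |apply wr].
  intros; apply w_nonneg.
Qed.

Lemma u_eq_right t : 0 < t < T -> ut t L = - nu * wx t L + r * u t L - (F t - w t L) ^ 2 / 4.
Proof.
  intros Ht. assert (S' := S). open_solution S'.
  apply Rle_antisym.
  - apply (le_at_limit_of_open (ut t) (fun x => - nu * wx t x + r * u t x - (F t - w t x) ^ 2 / 4) 0 L);
      [lra|intros; cont|intros; cont| |lra]. intros x Hx. rewrite equ by assumption. lra.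
  - apply (le_at_limit_of_open (fun x => - nu * wx t x + r * u t x - (F t - w t x) ^ 2 / 4) (ut t) 0 L);
      [lra|intros; cont|intros; cont| |lra]. intros x Hx. rewrite equ by assumption. lra.
Qed.

(** In the derivative of [RInt (w m phi)] the second order and the drift terms of
    the two equations cancel except where they meet [phi'].  The boundary terms have
    opposite signs at the two ends: [w * m_x >= 0] at 0 and [w_x * m <= 0] at [L]. *)
Lemma is_derive_moment a b t : 0 < t < T ->
  is_derive (moment a b) t
    (- nu * wx t L * m t L * (a * L ^ 2 + b) - nu * w t 0 * mx t 0 * b
     + r * moment a b t - a * remainder t).
Proof.
  intros Ht. assert (S' := S). open_solution S'.
  set (phi := fun x => a * x ^ 2 + b).
  set (P1 := fun tau s => ut tau L * (m s L * phi L) - ut tau 0 * (m s 0 * phi 0)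
     - RInt (fun x => ut tau x * (mx s x * phi x + m s x * (2 * a * x))) 0 L).
  assert (cphi : forall x, continuous phi x) by (intros; unfold phi; cont).
  apply is_derive_eq with (P1 t t + RInt (fun x => w t x * (mt t x * phi x)) 0 L).
  - apply (is_derive_diagonal (fun tau s => RInt (fun x => w tau x * (m s x * phi x)) 0 L)).
    + apply filter_imp with (fun s => 0 < s < T).
      * intros tau Htau s.
        apply (is_derive_pairing (fun x => m s x * phi x)
          (fun x => mx s x * phi x + m s x * (2 * a * x)) tau Htau); [intros; cont|intros; cont|].
        intros x Hx. unfold phi. deriv. ring.
      * now apply locally_between.
    + apply (is_derive_RInt_param_cont (fun s x => w t x * (m s x * phi x))
        (fun s x => w t x * (mt s x * phi x)) 0 L 0 T); [assumption|cont2_tac|cont2_tac|].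
      intros s Hs x. cbn beta. deriv. ring.
    + unfold P1. apply continuous_Rminus; [cont|].
      apply continuous_RInt_param; [lra|]. intros; cont.
  - unfold P1. rewrite ut_left by assumption.
    set (q := fun x => (F t - w t x) / 2).
    set (B := fun x => (q x ^ 2 - r * u t x) * (m t x * phi x)
       + w t x * phi x * (nu * mx t x + q x * m t x) + nu * (2 * a * x) * (w t x * m t x)).
    assert (E : RInt (fun x => -1 * (ut t x * (mx t x * phi x + m t x * (2 * a * x)))
         + w t x * (mt t x * phi x)) 0 L
       = B L - B 0 + RInt (fun x => r * (w t x * (m t x * phi x)) + - a *
       (4 * nu * x * w t x * mx t x + 2 * nu * w t x * m t x
          + x * (F t - w t x) * w t x * m t x)) 0 L).
    { apply (RInt_eq_flux _ _ B (fun x =>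
         (- q x * wx t x - r * w t x) * (m t x * phi x)
         + (q x ^ 2 - r * u t x) * (mx t x * phi x + m t x * (2 * a * x))
         + (wx t x * phi x + w t x * (2 * a * x)) * (nu * mx t x + q x * m t x)
         + w t x * phi x * mt t x
         + nu * (2 * a) * (w t x * m t x) + nu * (2 * a * x) * (wx t x * m t x + w t x * mx t x)));
       [lra|intros; cont|intros; cont|intros; unfold B, q; cont| |].
      - intros x Hx. unfold B, q, phi. rewrite eqm by lra. deriv. field.
      - intros x Hx. rewrite equ by lra. unfold q, phi. field. }
    rewrite !RInt_plus_cont, !RInt_scal_cont in E by (intros; cont).
    fold (remainder t) in E. fold (moment a b t) in E. fold (moment a b t).
    change (RInt (fun x => w t x * (m t x * phi x)) 0 L) with (moment a b t) in E.
    rewrite u_eq_right by assumption.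
    assert (EB : B L - B 0 = ((F t / 2) ^ 2 - r * u t L) * (m t L * phi L) - nu * w t 0 * mx t 0 * b).
    { unfold B, q, phi. rewrite wr, ml, ul. field. }
    rewrite EB in E. rewrite wr, ml.
    change (phi L) with (a * L ^ 2 + b) in E |- *. lra.
Qed.

Lemma moment_cont a b t : continuous (moment a b) t.
Proof.
  assert (S' := S). open_solution S'. apply continuous_RInt_param; [lra|]. intros; cont.
Qed.

Lemma moment_nonneg a b t : (forall x, 0 < x < L -> 0 <= a * x ^ 2 + b) -> 0 <= moment a b t.
Proof.
  intros Hab. assert (S' := S). open_solution S'.
  apply RInt_nonneg_cont; [lra|intros; cont|]. intros x Hx.
  apply Rmult_le_pos; [apply w_nonneg|]. apply Rmult_le_pos; [apply m_nonneg|now apply Hab].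
Qed.

Lemma le_of_discount_le t y A : 0 <= t <= T -> 0 <= y -> exp (- r * t) * y <= A -> y <= growth * A.
Proof.
  intros Ht Hy H. destruct (discount_bounds t Ht) as [_ Hg].
  replace y with (exp (r * t) * (exp (- r * t) * y)).
  - apply Rmult_le_compat; [apply Rlt_le, exp_pos| |exact Hg|exact H].
    apply Rmult_le_pos; [apply Rlt_le, exp_pos|exact Hy].
  - rewrite <- Rmult_assoc, <- exp_plus. replace (r * t + - r * t) with 0 by ring.
    rewrite exp_0; ring.
Qed.

Lemma remainder_integral_le s1 s2 : 0 <= s1 -> s1 <= s2 -> s2 <= T ->
  RInt (fun s => growth * remainder_majorant s) s1 s2 <= growth * remainder_bound.
Proof.
  intros H1 H2 H3. pose proof continuous_remainder_majorant as cN.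
  rewrite RInt_scal_cont by assumption. apply Rmult_le_compat_l; [apply Rlt_le, growth_pos|].
  eapply Rle_trans; [|apply remainder_majorant_integral_le].
  apply RInt_subinterval_le; try assumption. intros s Hs.
  eapply Rle_trans; [apply Rabs_pos|apply abs_remainder_le; lra].
Qed.

Lemma discounted_remainder_le s : 0 <= s <= T ->
  Rabs (exp (- r * s) * remainder s) <= growth * remainder_majorant s.
Proof.
  intros Hs. destruct (discount_bounds s Hs) as [[_ Hg] _].
  rewrite Rabs_mult, (Rabs_pos_eq (exp _)) by (apply Rlt_le, exp_pos).
  apply Rmult_le_compat; [apply Rlt_le, exp_pos|apply Rabs_pos|exact Hg|now apply abs_remainder_le].
Qed.

(** No bound of the slope at time 0 is available; an integration by parts puts
    the space derivative on [m0] instead, against the bounded function [u]. *)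
Lemma left_moment_initial_le :
  moment (-1) (L ^ 2) 0 <= L * (u_bound * (D1 * L ^ 2 + 2 * L * D0)).
Proof.
  assert (S' := S). open_solution S'.
  assert (HU := u_bound_nonneg).
  unfold moment.
  rewrite (RInt_eq_flux _ (fun x => - u 0 x * (mx 0 x * (L ^ 2 - x ^ 2) - 2 * x * m 0 x))
     (fun x => u 0 x * (m 0 x * (-1 * x ^ 2 + L ^ 2)))
     (fun x => w 0 x * (m 0 x * (-1 * x ^ 2 + L ^ 2))
        + u 0 x * (mx 0 x * (L ^ 2 - x ^ 2) - 2 * x * m 0 x)));
     [|lra|intros; cont|intros; cont|intros; cont| |intros; ring].
  - rewrite ul. replace (-1 * L ^ 2 + L ^ 2) with 0 by ring.
    assert (H : RInt (fun x => - u 0 x * (mx 0 x * (L ^ 2 - x ^ 2) - 2 * x * m 0 x)) 0 L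
       <= RInt (fun _ => u_bound * (D1 * L ^ 2 + 2 * L * D0)) 0 L).
    { apply RInt_le_cont; [lra|intros; cont|intros; cont|]. intros x Hx.
      assert (Hmx : Rabs (mx 0 x) <= D1).
      { replace (mx 0 x) with (m01 x); [apply m01_le, Hx|].
        symmetry. apply (derivatives_agree (m 0) m0 0 L x);
          [exact Hx| |now apply dmx|now apply m0_derive].
        intros y Hy. apply mi; lra. }
      apply Rabs_le_between in Hmx.
      assert (Hm0 : 0 <= m 0 x <= D0) by (split; [apply m_nonneg|rewrite mi; [apply m0_le|]; lra]).
      assert (Hu0 := u_nonneg 0 x). assert (Hu1 : u 0 x <= u_bound) by (apply u_le_bound; lra).
      replace (- u 0 x * (mx 0 x * (L ^ 2 - x ^ 2) - 2 * x * m 0 x))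
        with (u 0 x * (- mx 0 x * (L ^ 2 - x ^ 2) + 2 * x * m 0 x)) by ring.
      assert (HD : 0 <= D1 * L ^ 2 + 2 * L * D0).
      { apply Rplus_le_le_0_compat; apply Rmult_le_pos; try apply pow2_ge_0; lra. }
      apply Rle_trans with (u 0 x * (D1 * L ^ 2 + 2 * L * D0)); [|now apply Rmult_le_compat_r].
      apply Rmult_le_compat_l; [assumption|]. apply Rplus_le_compat.
      - assert (0 <= x ^ 2 <= L ^ 2) by (split; [apply pow2_ge_0|apply pow_incr; lra]).
        apply Rle_trans with (D1 * (L ^ 2 - x ^ 2)).
        + apply Rmult_le_compat_r; lra.
        + apply Rmult_le_compat_l; lra.
      - apply Rmult_le_compat; lra. }
    rewrite RInt_const_R in H. lra.
  - intros x Hx. deriv. ring.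
Qed.

Definition left_moment_bound :=
  growth * (L * (u_bound * (D1 * L ^ 2 + 2 * L * D0)) + growth * remainder_bound).

(** The weight [L ^ 2 - x ^ 2] removes the boundary term at [L]; the one at 0
    decreases the moment, which is therefore estimated forwards from time 0. *)
Lemma left_moment_le t : 0 <= t <= T -> moment (-1) (L ^ 2) t <= left_moment_bound.
Proof.
  intros Ht. assert (HM := growth_pos).
  pose proof continuous_remainder_majorant as cN. pose proof (moment_cont (-1) (L ^ 2)) as cm1.
  assert (S' := S). open_solution S'.
  assert (HI0 := left_moment_initial_le).
  assert (HN := remainder_integral_le 0 t ltac:(lra) ltac:(lra) ltac:(lra)).
  apply (le_of_discount_le t); [exact Ht| |].
  - apply moment_nonneg. intros x Hx. assert (x ^ 2 <= L ^ 2) by (apply pow_incr; lra). lra.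
  - set (E := fun s => RInt (fun s => growth * remainder_majorant s) 0 s
                       - exp (- r * s) * moment (-1) (L ^ 2) s).
    assert (H : E 0 <= E t).
    { apply (nondecreasing_of_derive E (fun s => growth * remainder_majorant s
         - exp (- r * s) * (- nu * w s 0 * mx s 0 * L ^ 2 + remainder s))); [lra| | |].
      - intros s. unfold E. cont. apply continuous_RInt_upper. intros; cont.
      - intros s Hs. unfold E. apply is_derive_Rminus.
        + apply (is_derive_RInt_upper (fun s => growth * remainder_majorant s)). intros; cont.
        + assert (Hd := is_derive_moment (-1) (L ^ 2) s ltac:(lra)). deriv. ring.
      - intros s Hs. assert (HR := discounted_remainder_le s ltac:(lra)).
        apply Rabs_le_between in HR.
        assert (0 <= exp (- r * s) * (nu * w s 0 * mx s 0 * L ^ 2)).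
        { repeat apply Rmult_le_pos; try apply pow2_ge_0; try lra;
            [apply Rlt_le, exp_pos|apply w_nonneg|apply mx_left_nonneg]. }
        lra. }
    unfold E in H. rewrite RInt_eq0, Rmult_0_r, exp_0 in H by (try intros; lra). lra.
Qed.

Definition right_moment_bound := growth * (growth * (L ^ 2 * D) + growth * remainder_bound).

(** The weight [x ^ 2] removes the boundary term at 0; the one at [L] increases
    the moment, which is therefore estimated backwards from time [T]. *)
Lemma right_moment_le t : 0 <= t <= T -> moment 1 0 t <= right_moment_bound.
Proof.
  intros Ht. assert (HM := growth_pos).
  pose proof continuous_remainder_majorant as cN. pose proof (moment_cont 1 0) as cm1.
  assert (S' := S). open_solution S'.
  assert (HN := remainder_integral_le t T ltac:(lra) ltac:(lra) ltac:(lra)).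
  assert (Hpos : forall s, 0 <= moment 1 0 s).
  { intros s. apply moment_nonneg. intros x Hx. pose proof (pow2_ge_0 x). lra. }
  assert (HIT : moment 1 0 T <= L ^ 2 * D).
  { assert (HD : 0 <= D).
    { apply Rle_trans with (uT1 (L / 2)); [apply uT1_nonneg|apply uT1_le]; lra. }
    apply Rle_trans with (RInt (fun x => L ^ 2 * D * m T x) 0 L).
    - apply RInt_le_cont; [lra|intros; cont|intros; cont|]. intros x Hx.
      replace (w T x * (m T x * (1 * x ^ 2 + 0))) with (x ^ 2 * w T x * m T x) by ring.
      apply Rmult_le_compat_r; [apply m_nonneg|].
      apply Rmult_le_compat; [apply pow2_ge_0|apply w_nonneg|apply pow_incr; lra|].
      rewrite w_final by assumption. now apply uT1_le.
    - rewrite RInt_scal_cont by (intros; cont). fold (mass L m T).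
      assert (H1 := mass_le_1 T ltac:(lra)).
      assert (0 <= L ^ 2 * D) by (apply Rmult_le_pos; [apply pow2_ge_0|exact HD]). nra. }
  apply (le_of_discount_le t); [exact Ht|apply Hpos|].
  set (E := fun s => RInt (fun s => growth * remainder_majorant s) t s
                     + exp (- r * s) * moment 1 0 s).
  assert (H : E t <= E T).
  { apply (nondecreasing_of_derive E (fun s => growth * remainder_majorant s
       + exp (- r * s) * (- nu * wx s L * m s L * L ^ 2 - remainder s))); [lra| | |].
    - intros s. unfold E. cont. apply continuous_RInt_upper. intros; cont.
    - intros s Hs. unfold E. apply is_derive_Rplus.
      + apply (is_derive_RInt_upper (fun s => growth * remainder_majorant s)). intros; cont.
      + assert (Hd := is_derive_moment 1 0 s ltac:(lra)). deriv. ring.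
    - intros s Hs. assert (HR := discounted_remainder_le s ltac:(lra)).
      apply Rabs_le_between in HR.
      assert (0 <= exp (- r * s) * (nu * (- wx s L) * m s L * L ^ 2)).
      { repeat apply Rmult_le_pos; try apply pow2_ge_0; try lra;
          [apply Rlt_le, exp_pos| |apply m_nonneg].
        pose proof (wx_right_nonpos s). lra. }
      lra. }
  unfold E in H. rewrite (RInt_eq0 _ t t) in H by (try intros; lra).
  destruct (discount_bounds T ltac:(lra)) as [[_ Hg] _].
  assert (exp (- r * T) * moment 1 0 T <= growth * (L ^ 2 * D)).
  { apply Rmult_le_compat; [apply Rlt_le, exp_pos|apply Hpos|exact Hg|exact HIT]. }
  lra.
Qed.

Lemma revenue_le t : 0 <= t <= T ->
  revenue t <= (left_moment_bound + right_moment_bound) / L ^ 2.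
Proof.
  intros Ht. assert (S' := S). open_solution S'.
  assert (0 < L ^ 2) by now apply pow_lt.
  assert (E : moment (-1) (L ^ 2) t + moment 1 0 t = L ^ 2 * revenue t).
  { unfold moment, revenue. rewrite <- RInt_plus_cont, <- RInt_scal_cont by (intros; cont).
    apply RInt_ext. intros x _. ring_R. }
  assert (H1 := left_moment_le t Ht). assert (H2 := right_moment_le t Ht).
  apply Rmult_le_reg_l with (L ^ 2); [assumption|].
  replace (L ^ 2 * (_ / L ^ 2)) with (left_moment_bound + right_moment_bound) by (field; lra).
  lra.
Qed.
End Estimates.

(** * Conclusion *)

(** A function differentiable within [[0, L]] is continuous there, hence bounded;
    clamping reduces this to functions continuous on [R]. *)
Lemma bounded_of_D_in (f d : R -> R) L :
  0 <= L -> (forall x, Icc 0 L x -> D_in f d (Icc 0 L) x) ->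
  exists K, forall x, 0 <= x <= L -> Rabs (f x) <= K.
Proof.
  intros HL Hd.
  destruct (bounded_on_interval (fun x => f (clamp L x)) L) as [K [_ HK]].
  - intros x. apply filterlim_locally. intros e.
    assert (Hc : Icc 0 L (clamp L x)) by now apply clamp_in.
    destruct (cont_deriv _ _ _ _ (Hd _ Hc) e (cond_pos e)) as [al [Hal H]].
    exists (mkposreal al Hal). intros y Hy.
    change (Rabs (f (clamp L y) - f (clamp L x)) < e).
    destruct (Req_dec (clamp L x) (clamp L y)) as [E|E].
    + rewrite E, Rminus_diag, Rabs_R0. apply cond_pos.
    + apply (H (clamp L y)). split; [split; [now apply clamp_in|exact E]|].
      eapply Rle_lt_trans; [apply clamp_dist|exact Hy].
  - exists K. intros x Hx. specialize (HK x Hx). cbn beta in HK. now rewrite clamp_id in HK.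
Qed.

(** The integrand is nonnegative, so one bound over [[0, L]] serves all
    subintervals. *)
Lemma revenue_bounded_on_subintervals
  (T L sigma eps r : R) (uT m0 : R -> R) :
  0 < T -> 0 < L -> 0 < sigma -> 0 <= eps -> admissible_data L uT m0 ->
  exists C, forall u ut ux uxx m mt mx mxx,
    smooth_solution T L sigma eps r uT m0 u ut ux uxx m mt mx mxx ->
    forall t c d, 0 <= t <= T -> 0 <= c -> c <= d -> d <= L ->
      Rabs (RInt (fun x => ux t x * m t x) c d) <= C.
Proof.
  intros HT HL Hs He (gamma & uT1 & uT2 & m01 & m02 & _ & HuT & Hm0 & _ & _ & Hm0p & Hm0i & HuTp & HuT1p).
  destruct HuT as [HuT1 HuT2 _]. destruct Hm0 as [Hm01 Hm02 _].
  destruct (bounded_of_D_in uT uT1 L) as [U0 HU0]; [lra|assumption|].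
  destruct (bounded_of_D_in uT1 uT2 L) as [D HD]; [lra|assumption|].
  destruct (bounded_of_D_in m0 m01 L) as [D0 HD0]; [lra|assumption|].
  destruct (bounded_of_D_in m01 m02 L) as [D1 HD1]; [lra|assumption|].
  assert (Hup : forall (f : R -> R) K x, Rabs (f x) <= K -> f x <= K).
  { intros f K x H. eapply Rle_trans; [apply Rle_abs|exact H]. }
  eexists. intros u ut ux uxx m mt mx mxx Hsol t c d Ht Hc Hcd Hd.
  assert (S := plane_solution_of_smooth _ _ _ _ _ _ _ _ _ _ _ _ _ _ _ HT HL Hs He Hsol).
  set (w := extend T L ux) in S. set (n := extend T L m) in S.
  assert (S' := S). open_solution S'.
  assert (dT : forall x, 0 < x < L -> is_derive uT x (uT1 x)).
  { intros x Hx. apply is_derive_of_D_in with 0 L; [apply HuT1; unfold Icc; lra|exact Hx]. }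
  assert (d0 : forall x, 0 < x < L -> is_derive m0 x (m01 x)).
  { intros x Hx. apply is_derive_of_D_in with 0 L; [apply Hm01; unfold Icc; lra|exact Hx]. }
  assert (HuT1i : forall x, 0 < x < L -> 0 <= uT1 x) by (intros x Hx; apply HuT1p; unfold Icc; lra).
  assert (Hnn : forall x, 0 <= w t x * n t x).
  { intros x. apply Rmult_le_pos.
    - exact (w_nonneg S Hm0p dT HuT1i t x).
    - exact (m_nonneg S Hm0p t x). }
  replace (RInt (fun x => ux t x * m t x) c d) with (RInt (fun x => w t x * n t x) c d).
  2:{ apply RInt_ext. rewrite Rmin_left, Rmax_right by lra. intros x Hx.
      unfold w, n, extend. now rewrite !clamp_id by lra. }
  rewrite Rabs_pos_eq by (apply RInt_nonneg_cont; [lra|intros; cont|intros; apply Hnn]).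
  eapply Rle_trans.
  { apply (RInt_subinterval_le (fun x => w t x * n t x) 0 c d L); [lra|lra|lra|intros; cont|].
    intros; apply Hnn. }
  refine (revenue_le S Hm0p Hm0i HuTp dT HuT1i _ _ _ d0 _ t Ht).
  - intros x Hx. exact (Hup _ _ _ (HU0 x Hx)).
  - intros x Hx. apply Hup, (HD x). lra.
  - intros x Hx. exact (Hup _ _ _ (HD0 x Hx)).
  - intros x Hx. apply (HD1 x). lra.
Qed.

Theorem proposition2p5
  (T L sigma eps r : R) (hT : 0 < T) (hL : 0 < L) (hsigma : 0 < sigma)
  (heps : 0 <= eps) (uT m0 : R -> R) (hdata : admissible_data L uT m0) :
  (forall delta : R, 0 < delta < L ->
    exists C : R, 0 < C /\
      forall u ut ux uxx m mt mx mxx : R -> R -> R,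
        smooth_solution T L sigma eps r uT m0 u ut ux uxx m mt mx mxx ->
        forall t : R, 0 <= t <= T ->
          Rabs (RInt (fun x => ux t x * m t x) 0 (L - delta)) <= C) /\
  (forall delta : R, 0 < delta < L ->
    exists C : R, 0 < C /\
      forall u ut ux uxx m mt mx mxx : R -> R -> R,
        smooth_solution T L sigma eps r uT m0 u ut ux uxx m mt mx mxx ->
        forall t : R, 0 <= t <= T ->
          Rabs (RInt (fun x => ux t x * m t x) delta L) <= C) /\
  (exists C : R,
      forall u ut ux uxx m mt mx mxx : R -> R -> R,
        smooth_solution T L sigma eps r uT m0 u ut ux uxx m mt mx mxx ->
        forall t : R, 0 <= t <= T ->
          Rabs (RInt (fun x => ux t x * m t x) 0 L) <= C).
Proof.
  destruct (revenue_bounded_on_subintervals T L sigma eps r uT m0) as [C HC]; try assumption.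
  assert (0 < Rabs C + 1) by (pose proof (Rabs_pos C); lra).
  pose proof (Rle_abs C).
  repeat split.
  - intros delta Hdelta. exists (Rabs C + 1). split; [assumption|].
    intros u ut ux uxx m mt mx mxx Hsol t Ht.
    specialize (HC _ _ _ _ _ _ _ _ Hsol t 0 (L - delta) Ht). lra.
  - intros delta Hdelta. exists (Rabs C + 1). split; [assumption|].
    intros u ut ux uxx m mt mx mxx Hsol t Ht.
    specialize (HC _ _ _ _ _ _ _ _ Hsol t delta L Ht). lra.
  - exists C. intros u ut ux uxx m mt mx mxx Hsol t Ht.
    apply (HC _ _ _ _ _ _ _ _ Hsol t 0 L Ht); lra.
Qed.
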